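(* Let $n\in\mathbb{Z}$ and let $A$ be an $\mathrm{SU}(3)$-invariant connection in temporal gauge on the $S^1$-bundle $E_n\to X^*$, where $X^*=T^*\mathbb{CP}^2\setminus\mathbb{CP}^2$ carries the Calabi hyperkähler structure, so that $A=A_{n,0}+(p_0(r)\kappa+p_1(r)\nu_1+p_2(r)\nu_2)\otimes T$ for some functions $p_0,p_1,p_2:(1,\infty)\to\mathbb{R}$. Then the following are equivalent: $A$ is an $\mathrm{Sp}(2)$-instanton; $A$ is an $I$-$\mathrm{Spin}(7)$-instanton with $(C_0,C_1,C_2)=(0,0,0)$; $A$ is a $J$-$\mathrm{Spin}(7)$-instanton with $(C_0,C_1,C_2)=(0,0,0)$; $A$ is a $K$-$\mathrm{Spin}(7)$-instanton with $(C_0,C_1,C_2)=(0,0,0)$ (constants as in the parametrization recalled in the context). Consequently, $E_n\to X^*$ admits a unique $\mathrm{SU}(3)$-invariant $\mathrm{Sp}(2)$-instanton up to gauge transformations, namely $$A=A_{n,0}-\frac{n}{r^2}\kappa\otimes T.$$ Its curvature is $$F_A=n\Big[\frac{2}{r^3}dr\wedge\kappa-\Big(1+\frac1{r^2}\Big)\mu_1\wedge\mu_2-\Big(1-\frac1{r^2}\Big)\sigma_1\wedge\sigma_2+\frac{2}{r^2}\nu_1\wedge\nu_2\Big]\otimes T.$$ In particular, for $n\neq0$, this $\mathrm{Sp}(2)$-instanton is not flat.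
   Context: **Calabi structure.** $\mathrm{SU}(3)$ acts on $X=T^*\mathbb{CP}^2$ in the standard way; $X^*$ is the complement of the zero section. Let $K_0=\{\mathrm{diag}(e^{i\theta},e^{i\theta},e^{-2i\theta})\}\cong\mathrm{U}(1)$ and $N_{1,1}=\mathrm{SU}(3)/K_0$. Write the left-invariant Maurer–Cartan form of $\mathrm{SU}(3)$ as $$\eta=\begin{bmatrix} i(\zeta+\kappa)&\nu&\sigma\\-\overline\nu&i(\zeta-\kappa)&\mu\\-\overline\sigma&-\overline\mu&-2i\zeta\end{bmatrix},\quad \nu=\nu_1+i\nu_2,\ \sigma=\sigma_1+i\sigma_2,\ \mu=\mu_1+i\mu_2,$$ which defines real left-invariant $1$-forms $\zeta,\kappa,\nu_j,\sigma_j,\mu_j$. There is an $\mathrm{SU}(3)$-equivariant diffeomorphism $X^*\cong(1,\infty)\times N_{1,1}$, with coordinate $r\in(1,\infty)$; forms on $X^*$ are identified with their pullbacks to $(1,\infty)\times\mathrm{SU}(3)$. Put $a=\sqrt{(r^2-1)/2}$, $b=\sqrt{(r^2+1)/2}$, $c=r$, $f=\frac1r\sqrt{r^4-1}$, $dt=\sqrt{r^4/(r^4-1)}\,dr$, and $e^0=dt$, $e^1=a\sigma_1$, $e^2=a\sigma_2$, $e^3=b\mu_1$, $e^4=b\mu_2$, $e^5=c\nu_1$, $e^6=c\nu_2$, $e^7=f\kappa$. The Calabi metric is $g=\sum_{j=0}^7(e^j)^2$, with orientation $e^{0}\wedge e^1\wedge\cdots\wedge e^7$ and Kähler forms ($e^{ij}=e^i\wedge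 e^j$) $$\omega_I=-e^{07}+e^{56}+e^{12}-e^{34},\quad \omega_J=-e^{06}-e^{57}-e^{23}+e^{14},\quad \omega_K=e^{05}-e^{67}+e^{24}+e^{13}.$$ Set $\Phi_I=\frac12(\omega_I^2+\omega_J^2-\omega_K^2)$, $\Phi_J=\frac12(-\omega_I^2+\omega_J^2+\omega_K^2)$, $\Phi_K=\frac12(\omega_I^2-\omega_J^2+\omega_K^2)$. A connection $A$ with curvature $F_A$ is an $L$-$\mathrm{Spin}(7)$-instanton ($L\in\{I,J,K\}$) if $\ast F_A=-\Phi_L\wedge F_A$; it is an $\mathrm{Sp}(2)$-instanton if $\ast F_A=-\frac12\omega_L^2\wedge F_A$ for all $L=I,J,K$. **Bundles and connections.** For $n\in\mathbb{Z}$ let $P_n=(\mathrm{SU}(3)\times S^1)/\!\sim$ with $(h,s)\sim(hz,sz^n)$ for $z\in\mathrm{U}(1)\cong K_0$ (via $e^{i\theta}\mapsto\mathrm{diag}(e^{i\theta},e^{i\theta},e^{-2i\theta})$), a principal $S^1$-bundle over $N_{1,1}$ with left $\mathrm{SU}(3)$-action and right $S^1$-action $[h,s]\cdot s'=[h,s'^{-1}s]$; $E_n=(1,\infty)\times P_n\to X^*$ is its pullback to $X^*$. $T$ is the standard basis vector of $\mathrm{Lie}(S^1)$. A connection on $E_n$ is in temporal gauge if its connection form has no $dr$ component; it is identified with its pullback to $(1,\infty)\times\mathrm{SU}(3)$ under $(r,h)\mapsto(r,[h,1])$. The canonical connection is $A_{n,0}=n\zeta\otimes T$. $\mathrm{SU}(3)$-invariant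 connections in temporal gauge are exactly those of the form displayed in the claim, and every invariant connection is gauge equivalent to one in temporal gauge. **Parametrization.** Invariant $L$-$\mathrm{Spin}(7)$-instantons in temporal gauge on $E_n$ are parametrized by constants $C_0,C_1,C_2\in\mathbb{R}$: for $L=I$, $p_0=-\frac1{r^2}(n+\frac{C_0}{r^4-1})$, $p_1=C_1(r^4-1)^{1/2}$, $p_2=C_2(r^4-1)^{-3/2}$; for $L=J$, $p_0=-\frac n{r^2}+C_0\frac{1-r^4}{r^2}$, $p_1=C_1(r^4-1)^{-3/2}$, $p_2=C_2(r^4-1)^{-3/2}$; for $L=K$, $p_0=-\frac1{r^2}(n+\frac{C_0}{r^4-1})$, $p_1=C_1(r^4-1)^{-3/2}$, $p_2=C_2(r^4-1)^{1/2}$. *)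

(* Defs.v *)
From HB Require Import structures.
From mathcomp Require Import all_boot all_order all_algebra.
From mathcomp Require Import sesquilinear spectral.
From mathcomp Require Import all_classical all_reals all_analysis.
From mathcomp Require Import complex.
Set Implicit Arguments.
Unset Strict Implicit.
Unset Printing Implicit Defensive.
Import Order.TTheory GRing.Theory Num.Theory.
Local Open Scope ring_scope.
Local Open Scope sesquilinear_scope.
Local Open Scope complex_scope.

Notation cRe := complex.Re.
Notation cIm := complex.Im.

(* Everything on X^* or on E_n is described by its pullback to
   M = (1,oo) x SU(3). A point of M, and a tangent vector to M, are elements of
   R x M_3(C), M being regarded as a submanifold of that space. *)
Notation Mpoint R := (R * 'M[R[i]]_3)%type.

(* Exterior algebra on nine generators, in coordinates: u I is the coefficient
   of the wedge product, in increasing order, of the generators indexed by I.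
   The generators are the left-invariant coframe
     0: dr, 1: sigma_1, 2: sigma_2, 3: mu_1, 4: mu_2, 5: nu_1, 6: nu_2,
     7: kappa, 8: zeta,
   so that e^0, ..., e^7 are multiples of generators 0, ..., 7. *)
Notation ext R := {ffun {set 'I_9} -> R^o}.
Notation Mform R := (Mpoint R -> ext R).

Section ExteriorAlgebra.
Variable R : realType.

Definition gen (k : 'I_9) : ext R := [ffun I => (I == [set k])%:R].

Definition shuffle_sign (I J : {set 'I_9}) : R :=
  (-1) ^+ #|[set x : 'I_9 * 'I_9 | [&& x.1 \in I, x.2 \in J & (x.2 < x.1)%N]]|.

Definition wedge (u v : ext R) : ext R :=
  [ffun K : {set 'I_9} => \sum_(I : {set 'I_9} | I \subset K)
     shuffle_sign I (K :\: I) * (u I * v (K :\: I))].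

Definition dr      : ext R := gen (inord 0).
Definition sigma1  : ext R := gen (inord 1).
Definition sigma2  : ext R := gen (inord 2).
Definition mu1     : ext R := gen (inord 3).
Definition mu2     : ext R := gen (inord 4).
Definition nu1     : ext R := gen (inord 5).
Definition nu2     : ext R := gen (inord 6).
Definition kappa   : ext R := gen (inord 7).
Definition zeta    : ext R := gen (inord 8).

End ExteriorAlgebra.

Infix "\wedge" := wedge (at level 40, left associativity).

Section SU3.
Variable R : realType.
Local Notation C := R[i].

Definition mx3 (s : seq (seq C)) : 'M[C]_3 :=
  \matrix_(i, j) nth 0 (nth [::] s i) j.

Definition SU3 (h : 'M[C]_3) : Prop := h \is unitarymx /\ \det h = 1.

Definition su3 (X : 'M[C]_3) : Prop := X ^t* = - X /\ \tr X = 0.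

Definition in_M (p : Mpoint R) : Prop := 1 < p.1 /\ SU3 p.2.

Definition K0 (z : 'M[C]_3) : Prop :=
  exists t : R, z = mx3 [:: [:: cos t +i* sin t; 0; 0];
                            [:: 0; cos t +i* sin t; 0];
                            [:: 0; 0; cos (- 2 * t) +i* sin (- 2 * t)]].

Definition K0_gen : 'M[C]_3 :=
  mx3 [:: [:: 'i; 0; 0]; [:: 0; 'i; 0]; [:: 0; 0; - 2 * 'i]].

(* The Maurer-Cartan matrix eta as a function of the values of the nine real
   coframe forms, the value x_0 of dr being ignored. *)
Definition eta_mx (x : 'rV[R]_9) : 'M[C]_3 :=
  let X k := x 0 (inord k) in
  let sigma := X 1 +i* X 2 in
  let mu := X 3 +i* X 4 in
  let nu := X 5 +i* X 6 in
  let kap := (X 7)%:C in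
  let zet := (X 8)%:C in
  mx3 [:: [:: 'i * (zet + kap); nu; sigma];
          [:: - nu^*; 'i * (zet - kap); mu];
          [:: - sigma^*; - mu^*; - 2 * 'i * zet]].

(* Values of the nine coframe forms on the vector whose dr-component is v.1 and
   whose Maurer-Cartan matrix is v.2. *)
Definition left_coord (v : R * 'M[C]_3) : 'rV[R]_9 :=
  let m : 'M[C]_3 := v.2 in
  \row_k nth 0 [:: v.1; cRe (m 0 2); cIm (m 0 2); cRe (m 1 2); cIm (m 1 2);
                   cRe (m 0 1); cIm (m 0 1);
                   (cIm (m 0 0) - cIm (m 1 1)) / 2;
                   (cIm (m 0 0) + cIm (m 1 1)) / 2] k.

(* The dual frame, in R x su(3). *)
Definition frame (k : 'I_9) : R * 'M[C]_3 :=
  ((k == inord 0)%:R, eta_mx (delta_mx 0 k)).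

Definition bracket (u v : R * 'M[C]_3) : R * 'M[C]_3 :=
  (0, u.2 *m v.2 - v.2 *m u.2).

(* Values at p of the coframe forms on v; the matrix part is h^-1 dh. *)
Definition coframe (p v : Mpoint R) : 'rV[R]_9 :=
  left_coord (v.1, invmx p.2 *m v.2).

Definition tangent (p v : Mpoint R) : Prop := su3 (invmx p.2 *m v.2).

End SU3.

Section Calculus.
Variable R : realType.
Local Notation C := R[i].

Definition dist (p q : Mpoint R) : R :=
  `|q.1 - p.1| + Num.sqrt (\sum_i \sum_j Normc.normc (q.2 i j - p.2 i j) ^+ 2).

Definition continuous_on_M (f : Mpoint R -> R) : Prop :=
  forall p, in_M p -> forall eps : R, 0 < eps ->
  exists2 delta : R, 0 < delta &
    forall q, in_M q -> dist p q < delta -> `|f q - f p| < eps.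

(* f, restricted to the submanifold M, is Frechet differentiable at p, with
   differential \sum_k D_k gen_k. *)
Definition is_differential (f : Mpoint R -> R) (p : Mpoint R) (D : 'rV[R]_9) :
    Prop :=
  forall eps : R, 0 < eps ->
  exists2 delta : R, 0 < delta &
    forall q, in_M q -> dist p q < delta ->
      `|f q - f p - \sum_k D 0 k * coframe p (q - p) 0 k| <= eps * dist p q.

(* Derivative of f along the k-th left-invariant frame field. *)
Definition deriv_frame (k : 'I_9) (f : Mpoint R -> R) : Mpoint R -> R :=
  fun p => xget 0 [set D | is_differential f p D]%classic 0 k.

(* M is parallelized by the frame, so C^m means that the iterated frame
   derivatives of order at most m exist and are continuous. *)
Fixpoint Ck (m : nat) (f : Mpoint R -> R) : Prop :=
  if m is m'.+1 then
    (forall p, in_M p -> exists D, is_differential f p D) /\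
    (forall k, Ck m' (deriv_frame k f))
  else continuous_on_M f.

Definition smooth (f : Mpoint R -> R) : Prop := forall m, Ck m f.

(* Exterior derivative of a 1-form, by the formula
   dA(X, Y) = X(A(Y)) - Y(A(X)) - A([X, Y]) on the frame fields. *)
Definition d1 (A : Mform R) : Mform R := fun p =>
  \sum_(a < 9) \sum_(b < 9 | (a < b)%N)
    (deriv_frame a (fun q => A q [set b]) p
     - deriv_frame b (fun q => A q [set a]) p
     - \sum_c A p [set c] * left_coord (bracket (frame R a) (frame R b)) 0 c)
    *: (gen R a \wedge gen R b).

Definition eval1 (A : Mform R) (p v : Mpoint R) : R :=
  \sum_k A p [set k] * coframe p v 0 k.

Definition eq_on_M (A B : Mform R) : Prop :=
  forall p, in_M p -> A p = B p.

End Calculus.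

(* Pullbacks A (x) T of connections on E_n under (r,h) |-> (r,[h,1]), identified
   with the real-valued 1-form A. Since [hz,1] = [h,1].z^n for z in K_0, these
   are the smooth 1-forms invariant under right translation by K_0 and taking
   the value n on the fundamental vector field of the K_0-action. *)
Section Bundle.
Variable R : realType.
Local Notation C := R[i].

Definition is_connection (n : int) (A : Mform R) : Prop :=
  [/\ forall p (I : {set 'I_9}), in_M p -> #|I| != 1%N -> A p I = 0,
      forall k, smooth (fun p => A p [set k]),
      forall z p v, K0 z -> in_M p -> tangent p v ->
        eval1 A (p.1, p.2 *m z) (v.1, v.2 *m z) = eval1 A p v &
      forall p, in_M p -> eval1 A p (0, p.2 *m K0_gen R) = n%:~R].

Definition is_invariant (A : Mform R) : Prop :=
  forall g p v, SU3 g -> in_M p -> tangent p v ->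
    eval1 A (p.1, g *m p.2) (v.1, g *m v.2) = eval1 A p v.

Definition temporal_gauge (A : Mform R) : Prop :=
  forall p, in_M p -> eval1 A p (1, 0) = 0.

(* Gauge transformations are the smooth maps u : X^* -> S^1, acting by
   A |-> A + u^-1 du; here u^-1 du = (u1 du2 - u2 du1) T for u = u1 + i u2. *)
Definition gauge_equivalent (A B : Mform R) : Prop :=
  exists u : Mpoint R -> C,
    let u1 := fun p => cRe (u p) in
    let u2 := fun p => cIm (u p) in
    [/\ smooth u1 /\ smooth u2,
        forall p, in_M p -> Normc.normc (u p) = 1,
        forall z p, K0 z -> in_M p -> u (p.1, p.2 *m z) = u p &
        forall p, in_M p ->
          B p = A p + \sum_k (u1 p * deriv_frame k u2 p
                              - u2 p * deriv_frame k u1 p) *: gen R k].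

Definition curvature (A : Mform R) : Mform R := d1 A.

Definition flat (A : Mform R) : Prop := eq_on_M (curvature A) (fun=> 0).

(* A_{n,0} + p0 kappa + p1 nu_1 + p2 nu_2 *)
Definition inv_connection (n : int) (p0 p1 p2 : R -> R) : Mform R := fun p =>
  n%:~R *: zeta R + p0 p.1 *: kappa R + p1 p.1 *: nu1 R + p2 p.1 *: nu2 R.

End Bundle.

Variant kahler := LI | LJ | LK.

Section Calabi.
Variable R : realType.

(* e^j = scale r j *: gen j for j = 0, ..., 7 *)
Definition scale (r : R) (j : nat) : R :=
  let a := Num.sqrt ((r ^+ 2 - 1) / 2) in
  let b := Num.sqrt ((r ^+ 2 + 1) / 2) in
  let c := r in
  let f := r^-1 * Num.sqrt (r ^+ 4 - 1) in
  nth 0 [:: Num.sqrt (r ^+ 4 / (r ^+ 4 - 1)); a; a; b; b; c; c; f] j.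

Definition e (p : Mpoint R) (j : nat) : ext R := scale p.1 j *: gen R (inord j).

(* Hodge star on forms pulled back from X^*, i.e. without zeta-component:
   the linear map with *(e^I) = sign(I, I^c) e^(I^c), I^c being the complement
   of I in {0, ..., 7}. *)
Definition hodge (p : Mpoint R) (u : ext R) : ext R :=
  [ffun K : {set 'I_9} => if inord 8 \in K then 0 else
     let I := ~: (inord 8 |: K) in
     shuffle_sign R I K
     * ((\prod_(j in K) scale p.1 j) / (\prod_(j in I) scale p.1 j)) * u I].

Definition ee (p : Mpoint R) (i j : nat) : ext R := e p i \wedge e p j.

Definition omega (L : kahler) : Mform R := fun p =>
  match L with
  | LI => - ee p 0 7 + ee p 5 6 + ee p 1 2 - ee p 3 4
  | LJ => - ee p 0 6 - ee p 5 7 - ee p 2 3 + ee p 1 4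
  | LK => ee p 0 5 - ee p 6 7 + ee p 2 4 + ee p 1 3
  end.

Definition Phi (L : kahler) : Mform R := fun p =>
  let sq L' := omega L' p \wedge omega L' p in
  2^-1 *: match L with
          | LI => sq LI + sq LJ - sq LK
          | LJ => - sq LI + sq LJ + sq LK
          | LK => sq LI - sq LJ + sq LK
          end.

Definition Spin7_instanton (L : kahler) (A : Mform R) : Prop :=
  forall p, in_M p ->
    hodge p (curvature A p) = - (Phi L p \wedge curvature A p).

Definition Sp2_instanton (A : Mform R) : Prop :=
  forall p, in_M p -> forall L,
    hodge p (curvature A p) =
    - ((2^-1 *: (omega L p \wedge omega L p)) \wedge curvature A p).

Definition param0 (L : kahler) (n : int) (C0 r : R) : R :=
  match L with
  | LI | LK => - (1 / r ^+ 2) * (n%:~R + C0 / (r ^+ 4 - 1))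
  | LJ => - (n%:~R / r ^+ 2) + C0 * ((1 - r ^+ 4) / r ^+ 2)
  end.

Definition param1 (L : kahler) (C1 r : R) : R :=
  match L with
  | LI => C1 * (r ^+ 4 - 1) `^ (1 / 2)
  | LJ | LK => C1 * (r ^+ 4 - 1) `^ (- (3 / 2))
  end.

Definition param2 (L : kahler) (C2 r : R) : R :=
  match L with
  | LI | LJ => C2 * (r ^+ 4 - 1) `^ (- (3 / 2))
  | LK => C2 * (r ^+ 4 - 1) `^ (1 / 2)
  end.

Definition Spin7_instanton_with (L : kahler) (n : int) (C0 C1 C2 : R)
    (A : Mform R) : Prop :=
  Spin7_instanton L A /\
  eq_on_M A
    (inv_connection n (param0 L n C0) (param1 L C1) (param2 L C2)).

End Calabi.

(* Main.v *)
Require Import Defs.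
From HB Require Import structures.
From mathcomp Require Import all_boot all_order all_algebra.
From mathcomp Require Import sesquilinear spectral.
From mathcomp Require Import all_classical all_reals all_analysis.
From mathcomp Require Import complex ring lra.
Set Implicit Arguments.
Unset Strict Implicit.
Unset Printing Implicit Defensive.
Import Order.TTheory GRing.Theory Num.Theory.
Import numFieldNormedType.Exports.
Local Open Scope ring_scope.
Local Open Scope sesquilinear_scope.
Local Open Scope complex_scope.
Local Open Scope classical_set_scope.

(* An invariant connection has coefficients depending on r alone. Right
   invariance under the element of K_0 of angle pi/3, which reverses the sigma
   and mu directions, kills four of them, so that
   A = b dr + n zeta + p0 kappa + p1 nu_1 + p2 nu_2. The Sp(2) equations are
   then algebraic: in the frame e^j, the equation for I forces F_13 = -F_24 and
   F_14 = F_23, while the structure equations give F_13, F_24 positive multiples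
   of p1 and F_23, -F_14 positive multiples of p2, whence p1 = p2 = 0; the
   equation for J forces F_12 = F_34, which reads (r^2 + 1)(n + p0) =
   (r^2 - 1)(n - p0), that is p0 = -n / r^2. Conversely, the curvature of
   n zeta - (n / r^2) kappa is
   (2n / r^4)(e^07 + e^56) - (2n / r^2)(e^12 + e^34), and both parentheses solve
   the three equations. The term b dr is removed by the gauge transformation
   exp(i G) with G' = b. *)

(** The equation $*F=-\frac12\omega^2\wedge F$ says that $F$ is primitive of type (1,1) for
    $\omega$; invariance of $F$ under the complex structures I and J is what ties its components in
    pairs. The pairs used contain no r-derivative, so no differential equation has to be solved. The
    angle pi/3 comes from the weight of $K_0$: conjugation multiplies the sigma and mu entries by
    $e^{\pm 3i\theta}$, which is -1 at pi/3, and fixes the nu, kappa and zeta entries, so exactly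
    these survive. Two obstacles shape the development. [deriv_frame] picks a differential by
    choice, so no derivative has a known value until differentials on M are shown to be unique; this
    takes points of M approaching p along every frame direction. And the exterior algebra on nine
    generators has 512 coefficients indexed by finite sets, so wedge products and Hodge stars are
    transferred to lists of integers with list keys, where the equations are checked by evaluation.
    This is possible because the dependence on r disappears in the orthonormal frame. *)

(** * Three-by-three matrices *)

Lemma ord3P (P : 'I_3 -> Prop) : P 0 -> P 1 -> P 2 -> forall i, P i.
Proof.
move=> P0 P1 P2 [[|[|[|//]]] lti].
- by rewrite (_ : Ordinal lti = 0) //; apply: val_inj.
- by rewrite (_ : Ordinal lti = 1) //; apply: val_inj.
- by rewrite (_ : Ordinal lti = 2) //; apply: val_inj.
Qed.

Lemma matrix3P (T : Type) (X Y : 'M[T]_3) :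
  X 0 0 = Y 0 0 -> X 0 1 = Y 0 1 -> X 0 2 = Y 0 2 ->
  X 1 0 = Y 1 0 -> X 1 1 = Y 1 1 -> X 1 2 = Y 1 2 ->
  X 2 0 = Y 2 0 -> X 2 1 = Y 2 1 -> X 2 2 = Y 2 2 -> X = Y.
Proof. by move=> *; apply/matrixP; apply: ord3P; apply: ord3P. Qed.

Lemma big_ord3 (V : nmodType) (F : 'I_3 -> V) :
  \sum_i F i = F 0 + F 1 + F 2.
Proof.
rewrite !big_ord_recl big_ord0 addr0 addrA.
by congr (_ + F _ + F _); apply: val_inj.
Qed.

Lemma mulmx3E (K : pzRingType) (X Y : 'M[K]_3) i j :
  (X *m Y) i j = X i 0 * Y 0 j + X i 1 * Y 1 j + X i 2 * Y 2 j.
Proof. by rewrite mxE big_ord3. Qed.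

Lemma det3 (K : comNzRingType) (X : 'M[K]_3) :
  \det X = X 0 0 * (X 1 1 * X 2 2 - X 1 2 * X 2 1)
         - X 0 1 * (X 1 0 * X 2 2 - X 1 2 * X 2 0)
         + X 0 2 * (X 1 0 * X 2 1 - X 1 1 * X 2 0).
Proof.
rewrite (expand_det_row _ 0) !big_ord_recl big_ord0 /cofactor.
rewrite !(expand_det_row _ ord0) !big_ord_recl !big_ord0 /cofactor !det_mx11 !mxE.
(* The cofactor expansions produce many forms of the same ordinal; passing through their values
   makes equal entries syntactically equal for [ring]. *)
pose f (i j : nat) := X (inord i) (inord j).
have E i j : X i j = f i j by rewrite /f !inord_val.
rewrite !{}E /= /bump /=.
rewrite ?(addn0,add0n,addn1,add1n) ?expr0 ?expr1 ?sqrrN ?expr1n /=.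
rewrite [(1 %% 3)%N]/= [(2 %% 3)%N]/=; ring.
Qed.

(** [mx3] over any ring, so that unitarity can be checked over an abstract [numClosedFieldType],
    with conjugation an opaque involution. *)
Definition M33 (K : pzRingType) (s : seq (seq K)) : 'M[K]_3 :=
  \matrix_(i, j) nth 0 (nth [::] s i) j.

Ltac mx3_entries := rewrite /M33 ?det3 ?(mulmx3E, mxE, big_ord3);
  rewrite ?[(1 %% 3)%N]/= ?[(2 %% 3)%N]/= /=.

(** * The group SU(3) *)

Section Unitary.
Variable K : numClosedFieldType.
Implicit Types a b : K.
Local Notation conj := Num.conj.

Definition emb01 a b : 'M[K]_3 :=
  M33 [:: [:: a; b; 0]; [:: - conj b; conj a; 0]; [:: 0; 0; 1]].
Definition emb02 a b : 'M[K]_3 :=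
  M33 [:: [:: a; 0; b]; [:: 0; 1; 0]; [:: - conj b; 0; conj a]].
Definition emb12 a b : 'M[K]_3 :=
  M33 [:: [:: 1; 0; 0]; [:: 0; a; b]; [:: 0; - conj b; conj a]].
Definition embz a : 'M[K]_3 :=
  M33 [:: [:: a; 0; 0]; [:: 0; a; 0]; [:: 0; 0; conj (a ^+ 2)]].

Ltac su3_entry := mx3_entries;
  rewrite ?(rmorphN, rmorph0, rmorph1, rmorphXn) /= ?conjCK.

Lemma unitary_emb01 a b : a * conj a + b * conj b = 1 ->
  emb01 a b \is unitarymx /\ \det (emb01 a b) = 1.
Proof.
move=> /(canRL (addrK _)) ab; split; first apply/unitarymxP; last by su3_entry; ring: ab.
by apply: matrix3P; su3_entry; ring: ab.
Qed.

Lemma unitary_emb02 a b : a * conj a + b * conj b = 1 ->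
  emb02 a b \is unitarymx /\ \det (emb02 a b) = 1.
Proof.
move=> /(canRL (addrK _)) ab; split; first apply/unitarymxP; last by su3_entry; ring: ab.
by apply: matrix3P; su3_entry; ring: ab.
Qed.

Lemma unitary_emb12 a b : a * conj a + b * conj b = 1 ->
  emb12 a b \is unitarymx /\ \det (emb12 a b) = 1.
Proof.
move=> /(canRL (addrK _)) ab; split; first apply/unitarymxP; last by su3_entry; ring: ab.
by apply: matrix3P; su3_entry; ring: ab.
Qed.

Lemma unitary_embz a : a * conj a = 1 ->
  embz a \is unitarymx /\ \det (embz a) = 1.
Proof.
move=> ab; split; first apply/unitarymxP; last by su3_entry; ring: ab.
by apply: matrix3P; su3_entry; ring: ab.
Qed.

Lemma unitary_mul (g h : 'M[K]_3) : g \is unitarymx /\ \det g = 1 ->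
  h \is unitarymx /\ \det h = 1 -> g *m h \is unitarymx /\ \det (g *m h) = 1.
Proof.
case=> ug dg [uh dh]; split; first exact: mul_unitarymx.
by rewrite det_mulmx dg dh mulr1.
Qed.

Lemma unitary_inv (g : 'M[K]_3) : g \is unitarymx /\ \det g = 1 ->
  invmx g \is unitarymx /\ \det (invmx g) = 1.
Proof.
case=> ug dg; split; last by rewrite det_inv dg invr1.
by rewrite invmx_unitary // trmxC_unitary.
Qed.
End Unitary.

Section SU3.
Variable R : realType.
Local Notation C := R[i].
Implicit Types (h g X Y : 'M[C]_3) (p q v : Mpoint R) (r s t : R).

Lemma SU3_unit h : SU3 h -> h \in unitmx.
Proof. by case=> /unitarymx_unit. Qed.

Lemma SU3_mul g h : SU3 g -> SU3 h -> SU3 (g *m h).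
Proof. exact: (@unitary_mul C g h). Qed.

Lemma SU3_inv g : SU3 g -> SU3 (invmx g).
Proof. exact: (@unitary_inv C g). Qed.

Lemma SU3_1 : SU3 (1%:M : 'M[C]_3).
Proof. by split; rewrite ?det1 //; apply/unitarymxP; rewrite mul1mx trmx1 map_mx1. Qed.

Lemma left_coordE (v : R * 'M[C]_3) (k : nat) : (k < 9)%N ->
  left_coord v 0 (inord k) =
  nth 0 [:: v.1; cRe (v.2 0 2); cIm (v.2 0 2); cRe (v.2 1 2); cIm (v.2 1 2);
            cRe (v.2 0 1); cIm (v.2 0 1);
            (cIm (v.2 0 0) - cIm (v.2 1 1)) / 2;
            (cIm (v.2 0 0) + cIm (v.2 1 1)) / 2] k.
Proof. by move=> k9; rewrite mxE inordK. Qed.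

Lemma ord9P (P : 'I_9 -> Prop) :
  P (inord 0) -> P (inord 1) -> P (inord 2) -> P (inord 3) -> P (inord 4) ->
  P (inord 5) -> P (inord 6) -> P (inord 7) -> P (inord 8) -> forall i, P i.
Proof.
move=> P0 P1 P2 P3 P4 P5 P6 P7 P8 i.
rewrite -(inord_val i); case: i => /= j lt.
by move: j lt; do 9![case=> [//|]].
Qed.

(* Each left-invariant frame vector is tangent to a curve in SU(3) along which
   the coframe of the chord is exactly [s] times a basis vector; with
   [c = sqrt (1 - s ^ 2)], it is a rotation in a coordinate plane, or a
   diagonal matrix. *)
Definition curve (k : nat) (s : R) : 'M[C]_3 :=
  let c := Num.sqrt (1 - s ^+ 2) in
  match k with
  | 0 => 1%:M
  | 1 => emb02 c%:C s%:C
  | 2 => emb02 c%:C (0 +i* s)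
  | 3 => emb12 c%:C s%:C
  | 4 => emb12 c%:C (0 +i* s)
  | 5 => emb01 c%:C s%:C
  | 6 => emb01 c%:C (0 +i* s)
  | 7 => emb01 (c +i* s) 0
  | _ => embz (c +i* s)
  end.

Lemma SU3_curve k s : `|s| <= 1 -> SU3 (curve k s).
Proof.
move=> s1; rewrite /curve; set c := Num.sqrt _.
have cs : c ^+ 2 + s ^+ 2 = 1.
  rewrite sqr_sqrtr; first by rewrite subrK.
  by rewrite subr_ge0 -real_normK ?num_real // expr_le1.
have E1 (z w : C) : cRe z ^+ 2 + cIm z ^+ 2 + (cRe w ^+ 2 + cIm w ^+ 2) = 1 ->
    z * Num.conj z + w * Num.conj w = 1.
  by rewrite -!normCK -!add_Re2_Im2 -rmorphD => ->.
have E2 (z : C) : cRe z ^+ 2 + cIm z ^+ 2 = 1 -> z * Num.conj z = 1.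
  by rewrite -normCK -add_Re2_Im2 => ->.
have [s0 c0] : (0 ^+ 2 + s ^+ 2 = s ^+ 2) /\ (c ^+ 2 + 0 ^+ 2 = c ^+ 2).
  by rewrite expr0n /= add0r addr0.
have s0' : s ^+ 2 + 0 ^+ 2 = s ^+ 2 by rewrite expr0n addr0.
case: k => [|[|[|[|[|[|[|[|k]]]]]]]]; first exact: SU3_1.
- by apply: unitary_emb02; apply: E1; rewrite /= c0 s0'.
- by apply: unitary_emb02; apply: E1; rewrite /= c0 s0.
- by apply: unitary_emb12; apply: E1; rewrite /= c0 s0'.
- by apply: unitary_emb12; apply: E1; rewrite /= c0 s0.
- by apply: unitary_emb01; apply: E1; rewrite /= c0 s0'.
- by apply: unitary_emb01; apply: E1; rewrite /= c0 s0.
- by apply: unitary_emb01; apply: E1; rewrite /= cs expr0n /= !addr0.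
- by apply: unitary_embz; apply: E2.
Qed.

Lemma inord_eq (a b : nat) : (a < 9)%N -> (b < 9)%N ->
  (inord a == inord b :> 'I_9) = (a == b).
Proof. by move=> a9 b9; rewrite -(inj_eq val_inj) /= !inordK. Qed.

Lemma cReB (z w : C) : cRe (z - w) = cRe z - cRe w.
Proof. by case: z w => [? ?] []. Qed.

Lemma cImB (z w : C) : cIm (z - w) = cIm z - cIm w.
Proof. by case: z w => [? ?] []. Qed.

Lemma left_coord_curve (k j : 'I_9) t s :
  left_coord (t, curve k s - 1%:M) 0 j =
  t *+ (j == inord 0) + s *+ ((j == k) && (k != inord 0)).
Proof.
move: k; apply: ord9P; rewrite inordK //; move: j; apply: ord9P;
  rewrite left_coordE // !inord_eq //=.
all: rewrite ?mxE ?[(1 %% 3)%N]/= ?[(2 %% 3)%N]/= /=.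
all: rewrite ?mulr0n ?mulr1n; lra.
Qed.

Lemma normc_le (z : C) : Normc.normc z <= `|cRe z| + `|cIm z|.
Proof.
case: z => x y /=; rewrite -(ler_pXn2r (n := 2)) ?nnegrE ?sqrtr_ge0 ?addr_ge0 //.
rewrite sqr_sqrtr ?addr_ge0 ?sqr_ge0 // sqrrD !real_normK ?num_real //.
by rewrite -addrA [_ *+ 2 + _]addrC addrA lerDl mulrn_wge0 // mulr_ge0.
Qed.

(** The largest entry comes from [embz]: the conjugate of $(c+is)^2$, minus 1, is $-2s^2-2ics$, with
    both parts at most $2|s|$. The other entries are controlled by $1-|s|\le c\le 1$. *)
Lemma curve_entry_le k s i j : `|s| <= 1 ->
  Normc.normc ((curve k s - 1%:M) i j) <= 4 * `|s|.
Proof.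
move=> s1.
suff: `|cRe ((curve k s - 1%:M) i j)| <= 2 * `|s| /\
      `|cIm ((curve k s - 1%:M) i j)| <= 2 * `|s|.
  move=> [H1 H2]; apply: le_trans (normc_le _) _; lra.
rewrite /curve; set c := Num.sqrt _.
have c0 : 0 <= c by apply: sqrtr_ge0.
have m0 : 0 <= `|s| by [].
have m2 : `|s| ^+ 2 = s ^+ 2 by rewrite real_normK ?num_real.
have c2 : c ^+ 2 = 1 - s ^+ 2.
  by rewrite sqr_sqrtr // subr_ge0 -m2 expr_le1.
have [s2 s3] : - `|s| <= s /\ s <= `|s| by apply/andP; rewrite -ler_norml.
move: (`|s|) m0 m2 s1 s2 s3 => m m0 m2 m1 s2 s3.
have c1 : c <= 1 by rewrite -(ler_pXn2r (n := 2)) ?nnegrE // c2; nra.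
have cm : 1 - m <= c.
  by rewrite -(ler_pXn2r (n := 2)) ?nnegrE ?subr_ge0 // c2 -m2; nra.
have ss0 : 0 <= s * s by nra.
have ss1 : s * s <= m by nra.
have cc : c * c = 1 - s * s by rewrite -!expr2.
have cs1 : - m <= c * s by nra.
have cs2 : c * s <= m by nra.
clearbody c; move: i; apply: ord3P; move: j; apply: ord3P.
all: case: k => [|[|[|[|[|[|[|[|k]]]]]]]].
all: rewrite ?mxE ?[(1 %% 3)%N]/= ?[(2 %% 3)%N]/= /=.
all: rewrite !ler_norml; lra.
Qed.

Lemma dist_le p q :
  dist p q <= `|q.1 - p.1| + \sum_i \sum_j Normc.normc (q.2 i j - p.2 i j).
Proof.
have n0 (z : C) : 0 <= Normc.normc z by case: z => x y; apply: sqrtr_ge0.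
have sqr_sum (I : finType) (F : I -> R) : (forall i, 0 <= F i) ->
    \sum_i F i ^+ 2 <= (\sum_i F i) ^+ 2.
  move=> F0; apply: (@proj2 (0 <= \sum_i F i)).
  elim/big_ind2: _ => [|x1 y1 x2 y2 [a0 a1] [b0 b1]|i _].
  - by rewrite expr0n.
  - by split; [exact: addr_ge0 | nra].
  - by split.
rewrite lerD2l -(ler_pXn2r (n := 2)) ?nnegrE ?sqrtr_ge0 //; last first.
  by apply: sumr_ge0 => i _; apply: sumr_ge0.
rewrite sqr_sqrtr; last first.
  by apply: sumr_ge0 => i _; apply: sumr_ge0 => j _; apply: sqr_ge0.
apply: le_trans (sqr_sum _ _ _); last by move=> i; apply: sumr_ge0.
by apply: ler_sum => i _; apply: sqr_sum.
Qed.

(** [coframe p (q - p)] is the increment that [is_differential] pairs with [D]. Along these points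
    it is exactly [s] times a basis vector, so the estimate isolates [D 0 k] with no second-order
    remainder. *)
Lemma frame_chord p (k : 'I_9) : in_M p -> exists A d : R, [/\ 0 < A, 0 < d &
  forall s, `|s| < d -> exists q, [/\ in_M q, q.1 = p.1 + s *+ (k == inord 0),
    forall j, coframe p (q - p) 0 j = s *+ (j == k) & dist p q <= A * `|s|]].
Proof.
move=> [p1 ph]; have pu := SU3_unit ph.
have n0 (z : C) : 0 <= Normc.normc z by case: z => x y; apply: sqrtr_ge0.
pose S := \sum_(i : 'I_3) \sum_(j : 'I_3) \sum_l Normc.normc (p.2 i l).
have S0 : 0 <= S by do 3![apply: sumr_ge0 => ? _].
(* The 1 accounts for the radial move and [4 * S] for the matrix part, by [curve_entry_le]. The
   bound 1 on [s] keeps the curve in SU(3), and [p.1 - 1] keeps the radius above 1. *)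
exists (1 + 4 * S), (Num.min 1 (p.1 - 1)); split.
- by rewrite ltr_pwDl // mulr_ge0.
- by rewrite lt_min ltr01 subr_gt0.
move=> s; rewrite lt_min => /andP[/ltW s1 s2].
exists (p.1 + s *+ (k == inord 0), p.2 *m curve k s).
split => /=; first split => /=; first 2 last.
- by [].
- move=> j; rewrite /coframe /= -[X in _ *m (_ - X)](mulmx1 p.2) -mulmxBr mulKmx //.
  rewrite left_coord_curve [p.1 + _]addrC addrK.
  by case: (eqVneq k (inord 0)) => [->|]; rewrite ?mulr0n ?mulr1n ?andbT ?andbF
    ?mulr0n ?addr0 ?mul0rn ?add0r.
- apply: le_trans (dist_le _ _) _ => /=.
  rewrite [p.1 + _]addrC addrK mulrDl mul1r; apply: lerD.
    by case: (_ == _); rewrite ?mulr1n ?mulr0n ?normr0.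
  rewrite mulrAC /S !mulr_sumr; apply: ler_sum => i _.
  rewrite mulr_sumr; apply: ler_sum => j _.
  have -> : (p.2 *m curve k s) i j - p.2 i j = (p.2 *m (curve k s - 1%:M)) i j.
    by rewrite mulmxBr mulmx1 !mxE.
  rewrite mulmx3E big_ord3.
  apply: le_trans (le_normcD _ _) _.
  apply: le_trans (lerD (le_normcD _ _) (lexx _)) _.
  rewrite !Normc.normcM !mulrDr.
  by do ![apply: lerD]; rewrite mulrC ler_wpM2r // curve_entry_le.
- have : - s <= `|s| by rewrite -normrN ler_norm.
  by case: (_ == _); rewrite ?mulr1n ?mulr0n ?addr0 //; lra.
- by apply: SU3_mul => //; apply: SU3_curve.
Qed.

End SU3.

(** * Differentials *)

Section Differential.
Variable R : realType.
Implicit Types (p q v : Mpoint R) (f : Mpoint R -> R) (D : 'rV[R]_9) (eps : R).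

Lemma is_differential_chord f p D (k : 'I_9) eps : in_M p ->
  is_differential f p D -> 0 < eps ->
  exists2 d : R, 0 < d & forall s, `|s| < d ->
  exists q, [/\ in_M q, q.1 = p.1 + s *+ (k == inord 0) &
    `|f q - f p - D 0 k * s| <= eps * `|s|].
Proof.
move=> pM fD e0; have [A [d [A0 d0 chord]]] := frame_chord k pM.
have eA0 : 0 < eps / A by rewrite divr_gt0.
have [d' d'0 fd'] := fD _ eA0.
exists (Num.min d (d' / A)); first by rewrite lt_min d0 divr_gt0.
move=> s; rewrite lt_min => /andP[/chord[q [qM q1 qc qd]]].
rewrite ltr_pdivlMr // mulrC => sd; exists q; split => //.
have {fd'} := fd' q qM (le_lt_trans qd sd).
rewrite (bigD1 k) //= big1 => [|j jk]; last by rewrite qc (negPf jk) mulr0.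
rewrite qc eqxx addr0 => /le_trans; apply.
rewrite -mulrA; apply: ler_wpM2l; first exact: ltW.
by rewrite mulrC ler_pdivrMr // [X in _ <= X]mulrC.
Qed.

(** This gives the choice made in [deriv_frame] a definite value. The difference of two
    differentials is a differential of the zero function; taking half of a nonzero component as
    tolerance contradicts the chord estimate. *)
Lemma differential_unique f p D D' : in_M p ->
  is_differential f p D -> is_differential f p D' -> D = D'.
Proof.
move=> pM fD fD'; apply/eqP; rewrite -subr_eq0; apply/eqP/rowP => k.
have zD : is_differential (fun=> 0) p (D - D').
  move=> eps e0; have e2 : 0 < eps / 2 by lra.
  have [d d0 H] := fD _ e2; have [d' d'0 H'] := fD' _ e2.
  exists (Num.min d d'); first by rewrite lt_min d0.
  move=> q qM; rewrite lt_min => /andP[/(H q qM) {}H /(H' q qM) {}H'].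
  rewrite (_ : _ - _ = (f q - f p - \sum_i D 0 i * coframe p (q - p) 0 i)
                     - (f q - f p - \sum_i D' 0 i * coframe p (q - p) 0 i)).
    by apply: le_trans (ler_normB _ _) _; lra.
  have E j : (D - D') 0 j = D 0 j - D' 0 j by rewrite !mxE.
  under eq_bigr do rewrite E mulrBl.
  by rewrite sumrB /=; ring.
rewrite [RHS]mxE; apply/eqP; apply: contraT; rewrite -normr_gt0 => D0.
have eps0 : 0 < `|(D - D') 0 k| / 2 by lra.
have [d d0 H] := is_differential_chord k pM zD eps0.
have /H[q [_ _]] : `|d / 2| < d by rewrite gtr0_norm; lra.
rewrite subr0 sub0r normrN normrM ler_pM2r; first lra.
by rewrite normr_gt0; lra.
Qed.

Lemma deriv_frameE f p D (k : 'I_9) : in_M p -> is_differential f p D ->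
  deriv_frame k f p = D 0 k.
Proof.
move=> pM fD; rewrite /deriv_frame; case: xgetP => [D' _ fD'|/(_ D)//].
by rewrite (differential_unique pM fD fD').
Qed.

Lemma is_differential_ext f g p D : in_M p -> (forall q, in_M q -> f q = g q) ->
  is_differential f p D -> is_differential g p D.
Proof.
move=> pM fg fD eps /fD[d d0 H]; exists d => // q qM.
by rewrite -!fg //; apply: H.
Qed.

(** The two sets of differentials are equal, hence so is the element picked by [xget], its default
    included. *)
Lemma deriv_frame_ext f g p (k : 'I_9) : in_M p ->
  (forall q, in_M q -> f q = g q) -> deriv_frame k f p = deriv_frame k g p.
Proof.
move=> pM fg; rewrite /deriv_frame; congr (fun_of_matrix (xget _ _) 0 k).
apply/seteqP; split => D; apply: is_differential_ext => // q qM.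
by rewrite fg.
Qed.

Lemma Ck_ext m f g : (forall q, in_M q -> f q = g q) -> Ck m f -> Ck m g.
Proof.
elim: m f g => [|m IH] f g fg /=.
  move=> fc p pM eps e0; have [d d0 H] := fc p pM eps e0.
  by exists d => // q qM; rewrite -!fg //; apply: H.
case=> fD fC; split=> [p pM|k].
  by have [D pD] := fD p pM; exists D; apply: is_differential_ext pD.
by apply: IH (fC k) => p pM; apply: deriv_frame_ext.
Qed.

Definition radial (g : R -> R) : Mpoint R -> R := fun p => g p.1.

Lemma dist_fst p q : `|q.1 - p.1| <= dist p q.
Proof. by rewrite lerDl sqrtr_ge0. Qed.

Lemma is_derive_radial g p d : is_derive p.1 1 g d ->
  is_differential (radial g) p (d *: delta_mx 0 (inord 0)).
Proof.
move=> [gd <-] eps e0.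
move/cvgrPdist_le : (gd) => /(_ _ e0) [del /= del0 H].
exists del => // q _ pq.
rewrite (bigD1 (inord 0)) //= big1 => [|j j0]; last first.
  by rewrite !mxE (negPf j0) mulr0 mul0r.
rewrite !mxE !eqxx mulr1 addr0 inordK //= /radial.
have [->|q0] := eqVneq q.1 p.1.
  rewrite !subrr mulr0 subrr normr0; apply: mulr_ge0; first exact: ltW.
  exact: le_trans (dist_fst p q).
have qp : q.1 - p.1 != 0 by rewrite subr_eq0.
have {}H : `|'D_1 g p.1 - (q.1 - p.1)^-1 * (g ((q.1 - p.1) * 1 + p.1) - g p.1)|
    <= eps.
  apply: (H (q.1 - p.1) _ qp).
  by rewrite /ball_ /= sub0r normrN (le_lt_trans (dist_fst _ _)).
rewrite mulr1 subrK in H.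
apply: le_trans (ler_wpM2l (ltW e0) (dist_fst p q)).
rewrite -ler_pdivrMr ?normr_gt0 // -normf_div mulrBl mulfK // distrC.
by rewrite mulrC.
Qed.

Lemma radial_is_derive g p D : in_M p -> is_differential (radial g) p D ->
  is_derive p.1 1 g (D 0 (inord 0)).
Proof.
move=> pM gD.
suff gcvg : ((fun h => h^-1 *: (g (h *: 1 + p.1) - g p.1)) @ 0^' --> D 0 (inord 0))%classic.
  by split; [apply/cvg_ex; exists (D 0 (inord 0)) | apply: cvg_lim].
apply/cvgrPdist_le => eps e0.
have [d d0 H] := is_differential_chord (inord 0) pM gD e0.
exists d => // s /=; rewrite sub0r normrN => /H[q [_]]; rewrite eqxx mulr1n /radial => ->.
move=> {}H s0.
suff : `|D 0 (inord 0) - s^-1 * (g (s * 1 + p.1) - g p.1)| <= eps by [].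
rewrite mulr1 distrC -(ler_pM2r (_ : 0 < `|s|)) ?normr_gt0 // -normrM mulrBl.
by rewrite [s^-1 * _]mulrC mulfVK // [s + _]addrC.
Qed.

Lemma deriv_radial g p d (k : 'I_9) : in_M p -> is_derive p.1 1 g d ->
  deriv_frame k (radial g) p = d *+ (k == inord 0).
Proof.
move=> pM /is_derive_radial /(deriv_frameE _ pM) ->.
by rewrite !mxE eqxx /= mulr_natr.
Qed.

(** If a differential exists, the k-th chord stays at constant radius, so its component vanishes; if
    none exists, [xget] returns the zero row. This lets [curvature_radial] treat arbitrary profile
    functions. *)
Lemma deriv_radial0 g p (k : 'I_9) : in_M p -> k != inord 0 ->
  deriv_frame k (radial g) p = 0.
Proof.
move=> pM k0; rewrite /deriv_frame; case: xgetP => [D _ fD|]; last by rewrite mxE.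
apply/eqP; apply: contraT; rewrite -normr_gt0 => D0.
have eps0 : 0 < `|D 0 k| / 2 by lra.
have [d d0 H] := is_differential_chord k pM fD eps0.
have /H[q [_]] : `|d / 2| < d by rewrite gtr0_norm; lra.
rewrite (negPf k0) mulr0n addr0 /radial => ->.
rewrite subrr sub0r normrN normrM ler_pM2r; first lra.
by rewrite normr_gt0; lra.
Qed.

End Differential.

(** * Smooth functions of the radius *)

Section RadialSmooth.
Variable R : realType.
Implicit Types (f g : R -> R) (r x : R) (p q : Mpoint R).

(** $C^m$ on $(1,\infty)$. The derivative is a witness constrained only there, so closure properties
    amount to exhibiting a formula. *)
Fixpoint Cm (m : nat) (g : R -> R) : Prop :=
  if m is m'.+1 then
    exists2 g', forall r, 1 < r -> is_derive r 1 g (g' r) & Cm m' g'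
  else forall r, 1 < r -> {for r, continuous g}.

Lemma is_derive_continuous g r d : is_derive r 1 g d -> {for r, continuous g}.
Proof.
by move=> gd; apply/differentiable_continuous/derivable1_diffP; case: gd.
Qed.

Lemma CmS m g : Cm m.+1 g -> Cm m g.
Proof.
elim: m g => [|m IH] g [g' gd] cg'; last by exists g' => //; apply: IH.
by move=> r /gd /is_derive_continuous.
Qed.

Lemma Cm_cst m x : Cm m (fun=> x).
Proof.
elim: m x => [|m IH] x; first by move=> r _; apply: cst_continuous.
by exists (fun=> 0) => // r _; apply: is_derive_cst.
Qed.

Lemma Cm_add m f g : Cm m f -> Cm m g -> Cm m (f \+ g).
Proof.
elim: m f g => [|m IH] f g /=.
  by move=> cf cg r r1; apply: continuousD; [apply: cf | apply: cg].
case=> f' fd cf [g' gd cg]; exists (f' \+ g'); last exact: IH.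
by move=> r r1; have := fd r r1; have := gd r r1 => ? ?; apply: is_deriveD.
Qed.

Lemma Cm_mul m f g : Cm m f -> Cm m g -> Cm m (f \* g).
Proof.
elim: m f g => [|m IH] f g.
  by move=> cf cg r r1; apply: continuousM; [apply: cf | apply: cg].
move=> cf cg; have [cf' cg'] := (CmS cf, CmS cg).
case: cf cg => f' fd cf [g' gd cg]; exists ((f \* g') \+ (g \* f')).
  move=> r r1; have := fd r r1; have := gd r r1 => ? ?.
  exact: is_deriveM.
by apply: Cm_add; apply: IH.
Qed.

Lemma is_derive_inv x : x != 0 -> is_derive x 1 (fun y => y^-1) (- (x^-1 * x^-1)).
Proof.
move=> x0; have dx : derivable (@id R) x 1 by exact: derivable_id.
split; first exact: derivableV.
rewrite (@deriveV R R id x 1) // derive_id /= -exprVn expr2.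
by rewrite [LHS]mulr1.
Qed.

Lemma Cm_inv m : Cm m (fun r => r^-1).
Proof.
have r0 r : 1 < r -> r != 0 by move=> r1; rewrite gt_eqF // (lt_trans ltr01).
elim: m => [|m IH].
  by move=> r /r0 /is_derive_inv /is_derive_continuous.
exists ((fun=> -1) \* ((fun r => r^-1) \* (fun r => r^-1))).
  by move=> r /r0 /is_derive_inv; rewrite /= mulN1r.
by apply: Cm_mul; [apply: Cm_cst | apply: Cm_mul].
Qed.

(** The induction is joint because the derivative of each function is, up to sign, the other one
    times [b]. *)
Lemma Cm_cos_sin m f b : (forall r, 1 < r -> is_derive r 1 f (b r)) ->
  (forall k, Cm k b) -> Cm m (cos \o f) /\ Cm m (sin \o f).
Proof.
move=> fb cb.
have cd r : 1 < r -> is_derive r 1 (cos \o f) (- sin (f r) * b r).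
  by move=> /fb fr; apply: is_derive1_comp.
have sd r : 1 < r -> is_derive r 1 (sin \o f) (cos (f r) * b r).
  by move=> /fb fr; apply: is_derive1_comp.
elim: m => [|m [IHc IHs]].
  by split=> r r1; [move: (cd r r1)|move: (sd r r1)] => /is_derive_continuous.
split; last by exists ((cos \o f) \* b) => //; apply: Cm_mul.
exists ((fun=> -1) \* ((sin \o f) \* b)); first by move=> r /cd; rewrite /= mulN1r mulNr.
by apply: Cm_mul; [apply: Cm_cst | apply: Cm_mul].
Qed.

Lemma Ck_cst m x : Ck m (radial (fun=> x)).
Proof.
elim: m x => [|m IH] x /=.
  by move=> p pM eps e0; exists 1 => // q qM _; rewrite /radial subrr normr0.
split=> [p pM|k].
  by exists (0 *: delta_mx 0 (inord 0)); apply: is_derive_radial; apply: is_derive_cst.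
apply: Ck_ext (IH 0) => p pM.
by rewrite (deriv_radial _ pM (is_derive_cst _ _ _)) mul0rn.
Qed.

Lemma Cm_Ck m g : Cm m g -> Ck m (radial g).
Proof.
elim: m g => [|m IH] g /=.
  move=> cg p [p1 _] eps e0.
  have /cvgrPdist_lt /(_ eps e0) [d /= d0 H] := cg p.1 p1.
  exists d => // q _ pq; rewrite distrC; apply: H.
  by rewrite /ball_ /= distrC (le_lt_trans (dist_fst _ _)).
case=> g' gd cg'; split=> [p [p1 _]|k].
  by exists (g' p.1 *: delta_mx 0 (inord 0)); apply: is_derive_radial; apply: gd.
have [->|k0] := eqVneq k (inord 0).
  apply: Ck_ext (IH _ cg') => p pM; have [p1 _] := pM.
  by rewrite (deriv_radial _ pM (gd _ p1)) eqxx mulr1n.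
apply: Ck_ext (Ck_cst m 0) => p pM; have [p1 _] := pM.
by rewrite (deriv_radial _ pM (gd _ p1)) (negPf k0).
Qed.

Lemma in_M1 r : 1 < r -> in_M (r, 1%:M : 'M[R[i]]_3).
Proof. by move=> r1; split=> //; apply: SU3_1. Qed.

(** Restriction to the points [(r, 1%:M)], where [dist] is the distance between radii. This is how
    smoothness of a connection on M makes its dr-coefficient a smooth function on the line, ready to
    be integrated. *)
Lemma Ck_Cm m g : Ck m (radial g) -> Cm m g.
Proof.
elim: m g => [|m IH] g /=.
  move=> cg r r1; apply/cvgrPdist_lt => eps e0.
  have [d d0 H] := cg _ (in_M1 r1) _ e0.
  near=> s; rewrite distrC; have s1 : 1 < s by near: s; apply: lt_nbhsr.
  apply: (H (s, 1%:M)); first exact: in_M1.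
  apply: le_lt_trans (dist_le _ _) _; rewrite big1 /= => [|i _]; last first.
    by rewrite big1 // => j _; rewrite subrr Normc.normc0.
  rewrite addr0 distrC; near: s; exact: (@nbhsx_ballx R R r d d0).
case=> gD gC; exists (fun r => 'D_1 g r).
  move=> r r1; have [D /(radial_is_derive (in_M1 r1)) gd] := gD _ (in_M1 r1).
  by split; [case: gd|].
apply: IH; apply: Ck_ext (gC (inord 0)) => p pM.
have [D /(radial_is_derive pM) gd] := gD p pM.
by rewrite (deriv_radial _ pM gd) eqxx /radial; case: gd => _ ->.
Unshelve. all: by end_near. Qed.

Lemma smooth_radialP g : smooth (radial g) <-> forall m, Cm m g.
Proof. by split=> H m; [apply/Ck_Cm/H | apply/Cm_Ck/H]. Qed.

End RadialSmooth.

(** * Primitives on a half-line *)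

Section Primitive.
Variable R : realType.
Local Notation mu := (@lebesgue_measure R).

Lemma primitive_exists (b : R -> R) (l : R) :
  (forall r, l < r -> {for r, continuous b}) ->
  exists G : R -> R, forall r, l < r -> is_derive r 1 G (b r).
Proof.
move=> cb.
have ib c u : l < c -> mu.-integrable `[c, u] (EFin \o b).
  move=> lc; apply: continuous_compact_integrable; first exact: segment_compact.
  apply: continuous_in_subspaceT => x; rewrite inE /= in_itv /= => /andP[cx _].
  by apply: cb; apply: lt_le_trans cx.
pose H c x := \int[mu]_(t in `[c, x]) b t.
pose a := l + 1.
(* The oriented integral from [a] to [x]: one of the two intervals is always empty. *)
pose G x := \int[mu]_(t in `]a, x]) b t - \int[mu]_(t in `]x, a]) b t.
have GE c x : l < c -> c < x -> c < a -> G x = H c x - H c a.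
  move=> lc cx ca; rewrite /G /H; have [ax|xa] := leP a x.
    rewrite [X in _ - \int[mu]_(t in X) _]set_itv_ge ?bnd_simp -?leNgt //
      Rintegral_set0 subr0.
    by rewrite -(@Rintegral_itvB _ _ (BLeft c)) ?bnd_simp ?ib // ltW.
  rewrite [X in \int[mu]_(t in X) _ - _]set_itv_ge ?bnd_simp -?leNgt ?ltW //
    Rintegral_set0 sub0r.
  by rewrite -(@Rintegral_itvB _ _ (BLeft c)) ?bnd_simp ?ib ?opprB // ltW.
exists G => r lr.
(* The fundamental theorem needs a left endpoint strictly below [r]. With [c] also below [a], [G]
   and [H c] differ by the constant [H c a] near [r]. *)
have [c [lc cr ca]] : exists c, [/\ l < c, c < r & c < a].
  exists (l + Num.min 1 (r - l) / 2); have : 0 < Num.min 1 (r - l).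
    by rewrite lt_min ltr01 subr_gt0.
  have : Num.min 1 (r - l) <= 1 by rewrite ge_min lexx.
  have : Num.min 1 (r - l) <= r - l by rewrite ge_min lexx orbT.
  rewrite /a; move: (Num.min _ _) => e *; split; lra.
apply: (@near_eq_is_derive _ _ _ (fun x => H c x - H c a)).
  near=> x; apply/esym/GE => //; near: x; exact: lt_nbhsr.
have [] := @continuous_FTC1_closed _ b c r (r + 1) _ (ib c (r + 1) lc) cr (cb r lr).
  by rewrite ltrDl.
rewrite derive1E => dH eH; rewrite -[b r]subr0.
have dH' : is_derive r 1 (H c) (b r) by split.
exact: is_deriveB.
Unshelve. all: by end_near. Qed.

End Primitive.

(** * Exterior algebra *)

Section Exterior.
Variable R : realType.
Implicit Types (u v w : ext R) (I J K : {set 'I_9}) (s t : seq nat) (c : nat -> R).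

Lemma wedgeDl u v w : (u + v) \wedge w = u \wedge w + v \wedge w.
Proof.
apply/ffunP => K; rewrite !ffunE -big_split; apply: eq_bigr => I _ /=.
by rewrite ffunE mulrDl mulrDr.
Qed.

Lemma wedgeDr u v w : w \wedge (u + v) = w \wedge u + w \wedge v.
Proof.
apply/ffunP => K; rewrite !ffunE -big_split; apply: eq_bigr => I _ /=.
by rewrite ffunE !mulrDr.
Qed.

Lemma wedgeZl (x : R) u v : (x *: u) \wedge v = x *: (u \wedge v).
Proof.
apply/ffunP => K; rewrite !ffunE scaler_sumr; apply: eq_bigr => I _ /=.
by rewrite ffunE -[x *: u I]/(x * u I) -[RHS]/(x * _); ring.
Qed.

Lemma wedgeZr (x : R) u v : u \wedge (x *: v) = x *: (u \wedge v).
Proof.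
apply/ffunP => K; rewrite !ffunE scaler_sumr; apply: eq_bigr => I _ /=.
by rewrite ffunE -[x *: v _]/(x * v _) -[RHS]/(x * _); ring.
Qed.

Lemma wedge0l u : 0 \wedge u = 0.
Proof.
by apply/ffunP => K; rewrite !ffunE big1 // => I _; rewrite ffunE mul0r mulr0.
Qed.

Lemma wedge0r u : u \wedge 0 = 0.
Proof.
by apply/ffunP => K; rewrite !ffunE big1 // => I _; rewrite ffunE !mulr0.
Qed.

Definition monomial I : ext R := [ffun J => (J == I)%:R].

Lemma wedge_monomial I J : monomial I \wedge monomial J =
  if [disjoint I & J] then shuffle_sign R I J *: monomial (I :|: J) else 0.
Proof.
apply/ffunP => K; rewrite [LHS]ffunE.
have E L : monomial I L * monomial J (K :\: L) = ((L == I) && (K :\: L == J))%:R.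
  by rewrite !ffunE -mulnb natrM.
under eq_bigr do rewrite E.
rewrite (bigID (pred1 I)) /= [X in _ + X]big1 ?addr0 => [|L /andP[_ /negPf->]]; last first.
  by rewrite mulr0.
have [IK|IK] := boolP (I \subset K); last first.
  rewrite big_pred0 => [|L]; last first.
    by have [->|] := eqVneq L I; rewrite ?andbF // (negPf IK).
  case: ifP => _; rewrite !ffunE //.
  case: (eqVneq K _) IK => [->|_ _]; first by rewrite finset.subsetUl.
  by rewrite scaler0.
rewrite (big_pred1 I) => [|L]; last first.
  by rewrite /=; case: (eqVneq L I) => [->|]; rewrite ?IK ?andbF.
rewrite eqxx /=; have -> : (K :\: I == J) = [disjoint I & J] && (K == I :|: J).
  apply/eqP/andP => [<-|[dIJ /eqP->]].
    split; last first.
      by rewrite finset.setDE finset.setUIr finset.setUCr finset.setIT eq_sym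
        (finset.setUidPr IK).
    rewrite fintype.disjoint_sym finset.disjoints_subset; apply/fintype.subsetP => x.
    by rewrite !inE => /andP[].
  rewrite finset.setDUl finset.setDv finset.set0U; apply/finset.setDidPl.
  by rewrite fintype.disjoint_sym.
case: ifP => dIJ /=; rewrite ?mulr0 !ffunE //.
case: (eqVneq K _) => [->|]; last by rewrite mulr0 scaler0.
rewrite finset.setDUl finset.setDv finset.set0U; congr (shuffle_sign _ _ _ * _).
by apply/finset.setDidPl; rewrite fintype.disjoint_sym.
Qed.

(** Subsets presented by lists of naturals, so that unions, disjointness and signs can be
    evaluated. *)
Definition iset s : {set 'I_9} := [set x : 'I_9 | (x : nat) \in s]%SET.

Lemma in_iset s (x : 'I_9) : (x \in iset s) = ((x : nat) \in s).
Proof. by rewrite inE. Qed.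

Lemma iset_cat s t : iset s :|: iset t = iset (s ++ t).
Proof. by apply/setP => x; rewrite !inE mem_cat. Qed.

Lemma iset1 (k : nat) : (k < 9)%N -> iset [:: k] = [set inord k]%SET.
Proof.
by move=> k9; apply/setP => x; rewrite !inE -(inj_eq val_inj) /= inordK.
Qed.

Definition inversions s t : nat :=
  sumn [seq sumn [seq ((x \in s) && (y \in t) && (y < x)%N : nat)
    | y <- iota 0 9] | x <- iota 0 9].

Lemma shuffle_sign_iset s t :
  shuffle_sign R (iset s) (iset t) = (-1) ^+ inversions s t.
Proof.
congr (_ ^+ _); rewrite cardsE /= -sum1_card big_mkcond /=.
rewrite (eq_bigr (fun z : 'I_9 * 'I_9 =>
  ((z.1 : nat) \in s) && ((z.2 : nat) \in t) && (z.2 < z.1)%N : nat)); last first.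
  by move=> z _; rewrite -[z \in _]/(_ && _) !in_iset andbA; case: (_ && _).
rewrite -(pair_bigA _ (fun x y : 'I_9 =>
  (val x \in s) && (val y \in t) && (val y < val x)%N : nat)) /=.
rewrite /inversions sumnE big_map -[iota 0 9]/(index_iota 0 9) big_mkord.
by apply: eq_bigr => x _; rewrite sumnE big_map big_mkord.
Qed.

(** Its values are the canonical keys: sorted, without repetition, and below 9. On them [iset] is
    injective. *)
Definition increasing (P : pred nat) : seq nat := [seq x <- iota 0 9 | P x].

Lemma iset_increasing (P : pred nat) : iset (increasing P) = [set x : 'I_9 | P x]%SET.
Proof. by apply/setP => x; rewrite !inE mem_filter mem_iota add0n /= ltn_ord andbT. Qed.

Lemma iset_inj s t : s = increasing (mem s) -> t = increasing (mem t) ->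
  iset s = iset t -> s = t.
Proof.
move=> -> -> /setP E; apply: eq_in_filter => x; rewrite mem_iota add0n => /= x9.
have := E (Ordinal x9); rewrite !inE /= !mem_filter !mem_iota x9 /= !andbT.
by [].
Qed.

Definition disjoint_keys s t : bool := ~~ has (fun x => (x \in s) && (x \in t)) (iota 0 9).

Lemma disjoint_iset s t : [disjoint iset s & iset t]%B = disjoint_keys s t.
Proof.
apply/idP/idP; last first.
  move=> /hasPn H; rewrite fintype.disjoint_subset; apply/fintype.subsetP => x.
  rewrite !inE => xs; have := H x; rewrite mem_iota /= ltn_ord => /(_ isT).
  by rewrite xs.
move=> /pred0P H; apply/hasPn => x; rewrite mem_iota /= => x9.
by have := H (Ordinal x9); rewrite /= !inE /= => ->.
Qed.

Definition weight c I : R := \prod_(i in I) c i.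

Definition wmono c I : ext R := weight c I *: monomial I.

Lemma wedge_wmono c I J : wmono c I \wedge wmono c J =
  if [disjoint I & J]%B then shuffle_sign R I J *: wmono c (I :|: J) else 0.
Proof.
rewrite /wmono wedgeZl wedgeZr wedge_monomial; case: ifP => IJ; last first.
  by rewrite !scaler0.
rewrite !scalerA; congr (_ *: _).
rewrite /weight [in RHS](eq_bigl [predU I & J]) => [|x]; last by rewrite !inE.
by rewrite bigU //=; ring.
Qed.

(* Forms with integer coefficients in the basis [wmono c (iset s)], where
   [c = scale r] gives the orthonormal frame; products and Hodge stars of such
   lists can be decided by computation. *)
Definition zform := seq (int * seq nat).
Implicit Types l : zform.

Definition evalz c l : ext R := \sum_(x <- l) x.1%:~R *: wmono c (iset x.2).

Definition zmul l1 l2 : zform :=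
  [seq (if disjoint_keys x.2 y.2 then
          if odd (inversions x.2 y.2) then - (x.1 * y.1) else x.1 * y.1
        else 0,
        increasing (mem (x.2 ++ y.2))) | x <- l1, y <- l2].

Definition coef l s : int :=
  foldr (fun x n => if x.2 == s then x.1 + n else n) 0 l.

Lemma coefE l s : coef l s = \sum_(x <- l | x.2 == s) x.1.
Proof. by elim: l => [|x l IH]; rewrite ?big_nil // big_cons /= IH. Qed.

Lemma evalz_cat c l1 l2 : evalz c (l1 ++ l2) = evalz c l1 + evalz c l2.
Proof. by rewrite /evalz big_cat. Qed.

Lemma wedge_suml (T : Type) (r : seq T) (F : T -> ext R) u :
  (\sum_(i <- r) F i) \wedge u = \sum_(i <- r) (F i \wedge u).
Proof.
by elim: r => [|x r IH]; rewrite ?big_nil ?wedge0l // !big_cons wedgeDl IH.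
Qed.

Lemma wedge_sumr (T : Type) (r : seq T) (F : T -> ext R) u :
  u \wedge (\sum_(i <- r) F i) = \sum_(i <- r) (u \wedge F i).
Proof.
by elim: r => [|x r IH]; rewrite ?big_nil ?wedge0r // !big_cons wedgeDr IH.
Qed.

Lemma evalz_mul c l1 l2 : evalz c l1 \wedge evalz c l2 = evalz c (zmul l1 l2).
Proof.
rewrite /evalz wedge_suml big_allpairs_dep; apply: eq_bigr => x _.
rewrite wedge_sumr; apply: eq_bigr => y _ /=.
rewrite wedgeZl wedgeZr wedge_wmono disjoint_iset.
case: disjoint_keys; last by rewrite !scaler0 scale0r.
rewrite shuffle_sign_iset iset_cat -signr_odd !scalerA.
have -> : iset (increasing (mem (x.2 ++ y.2))) = iset (x.2 ++ y.2).
  by rewrite iset_increasing; apply/setP => z; rewrite !inE.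
congr (_ *: _); case: odd; rewrite ?expr1 ?expr0 ?mulrN1 ?mulr1 ?rmorphN rmorphM //.
Qed.

Definition canonical_keys l := all (fun x : int * seq nat => x.2 == increasing (mem x.2)) l.

Lemma evalz_coef c l s : canonical_keys l -> s = increasing (mem s) ->
  evalz c l (iset s) = (coef l s)%:~R * weight c (iset s).
Proof.
move=> /allP lc sc; rewrite /evalz coefE rmorph_sum mulr_suml sum_ffunE.
rewrite [RHS]big_mkcond /= !big_seq; apply: eq_bigr => x xl.
rewrite /wmono !ffunE.
have [->|xs] := eqVneq x.2 s; first by rewrite eqxx; congr (_ * _); exact: mulr1.
case: eqVneq => [E|_]; last by rewrite !scaler0.
by case/eqP: xs; apply: iset_inj => //; apply/eqP/lc.
Qed.

(** Testing the keys that occur suffices: every subset has a canonical key, and at a key that does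
    not occur the coefficient is an empty sum. *)
Lemma evalz_eq0 c l : canonical_keys l -> all (fun x => coef l x.2 == 0) l ->
  evalz c l = 0.
Proof.
move=> lc /allP l0; apply/ffunP => J; rewrite [RHS]ffunE.
pose s := increasing (mem [seq val x | x in J]).
have sJ : iset s = J.
  rewrite iset_increasing; apply/setP => x; rewrite inE /= mem_map; last exact: val_inj.
  by rewrite mem_enum.
have sc : s = increasing (mem s).
  by apply: eq_in_filter => x xi /=; rewrite mem_filter xi andbT.
rewrite -sJ evalz_coef //; have [/hasP[x xl /eqP <-]|/hasPn H] :=
  boolP (has (fun x => x.2 == s) l).
  by rewrite (eqP (l0 x xl)) mul0r.
by rewrite coefE big_seq_cond big1 ?mul0r // => x /andP[/H/negPf->].
Qed.

End Exterior.

(** * The Hodge star and the instanton defect *)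

Section Hodge.
Variable R : realType.
Implicit Types (u v w : ext R) (s t : seq nat) (p : Mpoint R) (l : zform).

Lemma hodgeD p u v : hodge p (u + v) = hodge p u + hodge p v.
Proof.
apply/ffunP => K; rewrite !ffunE; case: ifP => _; first by rewrite addr0.
by rewrite /= ffunE mulrDr.
Qed.

Lemma hodgeZ p (x : R) u : hodge p (x *: u) = x *: hodge p u.
Proof.
apply/ffunP => K; rewrite !ffunE; case: ifP => _; first by rewrite scaler0.
by rewrite /= ffunE -[x *: u _]/(x * u _) -[RHS]/(x * _); ring.
Qed.

Lemma hodge_sum p (T : Type) (r : seq T) (F : T -> ext R) :
  hodge p (\sum_(i <- r) F i) = \sum_(i <- r) hodge p (F i).
Proof.
elim: r => [|x r IH]; last by rewrite !big_cons hodgeD IH.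
by rewrite !big_nil -[X in hodge p X](scale0r (0 : ext R)) hodgeZ scale0r.
Qed.

Lemma scale_gt0 (r : R) (k : nat) : 1 < r -> (k < 8)%N -> 0 < scale r k.
Proof.
move=> r1 k8; have r0 : 0 < r by apply: lt_trans r1.
have r2 : 1 < r ^+ 2 by rewrite exprn_egt1.
have r4 : 1 < r ^+ 4 by rewrite exprn_egt1.
have a0 : 0 < Num.sqrt ((r ^+ 2 - 1) / 2) by rewrite sqrtr_gt0; lra.
have b0 : 0 < Num.sqrt ((r ^+ 2 + 1) / 2) by rewrite sqrtr_gt0; lra.
have f0 : 0 < r^-1 * Num.sqrt (r ^+ 4 - 1).
  by rewrite mulr_gt0 ?invr_gt0 // sqrtr_gt0; lra.
have t0 : 0 < Num.sqrt (r ^+ 4 / (r ^+ 4 - 1)).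
  by rewrite sqrtr_gt0 divr_gt0 //; lra.
by move: k k8; do 8![case=> [//|]].
Qed.

(** Index 8 is excluded because [scale r 8] is the default 0 of [nth]: zeta is not in the
    orthonormal coframe. *)
Lemma weight_scale_neq0 p s : 1 < p.1 -> 8%N \notin s ->
  weight (scale p.1) (iset s) != 0.
Proof.
move=> p1 s8; rewrite /weight prodf_seq_neq0; apply/allP => x _; apply/implyP.
rewrite in_iset => xs; rewrite gt_eqF // scale_gt0 //; move: (ltn_ord x).
by rewrite ltnS leq_eqVlt; case/predU1P => // x8; rewrite x8 (negPf s8) in xs.
Qed.

Definition hodge_key s : seq nat := [seq x <- iota 0 8 | x \notin s].

Lemma hodge_wmono p s : 1 < p.1 -> 8%N \notin s ->
  hodge p (wmono (scale p.1) (iset s)) =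
  shuffle_sign R (iset s) (iset (hodge_key s)) *: wmono (scale p.1) (iset (hodge_key s)).
Proof.
move=> p1 s8; apply/ffunP => K.
have iset_key : iset (hodge_key s) = ~: (inord 8 |: iset s)%SET.
  apply/setP => x; rewrite !inE negb_or mem_filter mem_iota add0n leq0n /=.
  rewrite -(inj_eq val_inj) /= inordK // andbC; congr (_ && _).
  by move: (ltn_ord x); rewrite ltnS leq_eqVlt; case: ltngtP.
rewrite /wmono !ffunE; have [K8|K8] := boolP (inord 8 \in K).
  case: eqVneq => [KE|_]; last by rewrite !scaler0.
  by move: K8; rewrite KE iset_key !inE eqxx.
rewrite /= !ffunE; have -> : (~: (inord 8 |: K)%SET == iset s) = (K == iset (hodge_key s)).
  have s8' : inord 8 \notin iset s by rewrite in_iset inordK.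
  rewrite iset_key; apply/eqP/eqP => [<-|->]; apply/setP => x; rewrite !inE.
    by case: eqVneq => [->|] /=; rewrite ?negbK // (negPf K8).
  by case: eqVneq => [->|] /=; rewrite ?negbK //; move: s8'; rewrite inE => /negPf ->.
case: eqVneq => [KE|_]; last by rewrite !scaler0 mulr0.
have <- : iset s = ~: (inord 8 |: K)%SET.
  rewrite KE iset_key; apply/setP => x; rewrite !inE.
  case: eqVneq => [->|] /=; last by rewrite negbK.
  by rewrite inordK // (negPf s8).
have w0 := weight_scale_neq0 p1 s8.
rewrite KE -/(weight _ _) -/(weight _ _).
rewrite -[_ *: 1%:R]/(_ * 1) -[_ *: 1%:R]/(_ * 1) -[RHS]/(_ * _).
by rewrite !mulr1 -mulrA divfK.
Qed.

Definition zhodge l : zform :=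
  [seq (if odd (inversions x.2 (hodge_key x.2)) then - x.1 else x.1, hodge_key x.2) | x <- l].

Lemma hodge_evalz p l : 1 < p.1 -> all (fun x => 8%N \notin x.2) l ->
  hodge p (evalz (scale p.1) l) = evalz (scale p.1) (zhodge l).
Proof.
move=> p1 /allP l8; rewrite /evalz hodge_sum big_map !big_seq.
apply: eq_bigr => x /l8 x8; rewrite hodgeZ hodge_wmono // scalerA.
rewrite shuffle_sign_iset -signr_odd; congr (_ *: _) => /=.
by case: odd; rewrite ?expr1 ?expr0 ?mulrN1 ?mulr1 ?rmorphN.
Qed.

Definition zomega (L : kahler) : zform :=
  match L with
  | LI => [:: (-1, [:: 0; 7]%N); (1, [:: 5; 6]%N); (1, [:: 1; 2]%N); (-1, [:: 3; 4]%N)]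
  | LJ => [:: (-1, [:: 0; 6]%N); (-1, [:: 5; 7]%N); (-1, [:: 2; 3]%N); (1, [:: 1; 4]%N)]
  | LK => [:: (1, [:: 0; 5]%N); (-1, [:: 6; 7]%N); (1, [:: 2; 4]%N); (1, [:: 1; 3]%N)]
  end.

Lemma evalz_seq1 (c : nat -> R) (x : int) s :
  evalz c [:: (x, s)] = x%:~R *: wmono c (iset s).
Proof. by rewrite /evalz big_seq1. Qed.

Lemma evalz_cons (c : nat -> R) (x : int) s l :
  evalz c ((x, s) :: l) = x%:~R *: wmono c (iset s) + evalz c l.
Proof. by rewrite /evalz big_cons. Qed.

Lemma e_evalz p k : (k < 9)%N -> e p k = evalz (scale p.1) [:: (1, [:: k])].
Proof.
move=> k9; rewrite evalz_seq1 scale1r /wmono iset1 //; congr (_ *: _).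
by rewrite /weight big_set1 inordK.
Qed.

Lemma wedge_wmono2 (c : nat -> R) i j : (i < j < 9)%N ->
  wmono c (iset [:: i]) \wedge wmono c (iset [:: j]) = wmono c (iset [:: i; j]).
Proof.
case/andP=> ij j9; rewrite wedge_wmono !disjoint_iset.
have -> : disjoint_keys [:: i] [:: j].
  by apply/hasPn => x _; rewrite !inE; case: eqVneq => [->|//]; rewrite ltn_eqF.
rewrite iset_cat /shuffle_sign (_ : [set x | _]%SET = finset.set0) ?finset.cards0 ?scale1r //.
apply/setP => -[x y]; rewrite !inE /=; apply/negP => /and3P[/eqP -> /eqP ->].
by rewrite ltnNge ltnW.
Qed.

Lemma eeE p i j : (i < j < 9)%N -> ee p i j = wmono (scale p.1) (iset [:: i; j]).
Proof.
move=> ij9; case/andP: (ij9) => ij j9.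
by rewrite /ee !e_evalz ?(ltn_trans ij) // !evalz_seq1 !scale1r wedge_wmono2.
Qed.

Lemma wedge_genE p i j : 1 < p.1 -> (i < j < 8)%N ->
  gen R (inord i) \wedge gen R (inord j) =
  (scale p.1 i * scale p.1 j)^-1 *: wmono (scale p.1) (iset [:: i; j]).
Proof.
move=> p1 /andP[ij j8]; have i8 := ltn_trans ij j8.
have ij9 : (i < j < 9)%N by rewrite ij ltnW.
rewrite -(eeE p ij9) /ee /e wedgeZl wedgeZr !scalerA mulVf ?scale1r //.
by rewrite mulf_neq0 // gt_eqF // scale_gt0.
Qed.

Lemma omega_evalz L p : omega L p = evalz (scale p.1) (zomega L).
Proof.
by case: L; rewrite /omega /zomega !evalz_cons !eeE // /evalz big_nil addr0
  ?scaleN1r ?scale1r ?rmorphN ?rmorph1 ?scaleN1r ?scale1r ?addrA.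
Qed.

(* Twice [defect L], so as to keep integer coefficients. *)
Definition zdefect L l : zform :=
  zhodge l ++ zhodge l ++ zmul (zmul (zomega L) (zomega L)) l.

Definition defect L p u : ext R :=
  hodge p u + (2^-1 *: (omega L p \wedge omega L p)) \wedge u.

Lemma defectP L p u :
  hodge p u = - ((2^-1 *: (omega L p \wedge omega L p)) \wedge u) <-> defect L p u = 0.
Proof. by rewrite /defect; split => [->|/eqP]; rewrite ?addNr // addr_eq0 => /eqP. Qed.

Lemma defectD L p u v : defect L p (u + v) = defect L p u + defect L p v.
Proof. by rewrite /defect hodgeD wedgeDr addrACA. Qed.

Lemma defectZ L p (x : R) u : defect L p (x *: u) = x *: defect L p u.
Proof. by rewrite /defect hodgeZ wedgeZr scalerDr. Qed.

Lemma defect_evalz L p l : 1 < p.1 -> all (fun x => 8%N \notin x.2) l ->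
  defect L p (evalz (scale p.1) l) = 2^-1 *: evalz (scale p.1) (zdefect L l).
Proof.
move=> p1 l8; rewrite /defect hodge_evalz // omega_evalz wedgeZl !evalz_mul.
rewrite /zdefect !evalz_cat addrA -[in RHS]mulr2n scalerDr; congr (_ + _).
by rewrite -[evalz _ _ *+ 2]scaler_nat scalerA mulVf ?scale1r // pnatr_eq0.
Qed.

Lemma defect_evalz_eq0 L p l : 1 < p.1 -> all (fun x => 8%N \notin x.2) l ->
  canonical_keys (zdefect L l) ->
  all (fun x => coef (zdefect L l) x.2 == 0) (zdefect L l) ->
  defect L p (evalz (scale p.1) l) = 0.
Proof. by move=> p1 l8 lc l0; rewrite defect_evalz // evalz_eq0 ?scaler0. Qed.

(** $e^{07}+e^{56}$ is primitive of type (1,1) for I, J and K at once; its two terms separately are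
    not. The same holds for $e^{12}+e^{34}$ below. *)
Lemma defect_07_56 L p : 1 < p.1 ->
  defect L p (evalz (scale p.1) [:: (1, [:: 0; 7]%N); (1, [:: 5; 6]%N)]) = 0.
Proof.
move=> p1; apply: defect_evalz_eq0 => //; first by case: L; vm_compute.
by case: L; vm_compute.
Qed.

Lemma defect_12_34 L p : 1 < p.1 ->
  defect L p (evalz (scale p.1) [:: (1, [:: 1; 2]%N); (1, [:: 3; 4]%N)]) = 0.
Proof.
move=> p1; apply: defect_evalz_eq0 => //; first by case: L; vm_compute.
by case: L; vm_compute.
Qed.

(** Extracts component [s] of the equation as a linear relation between the coefficients of [F],
    with integer multipliers [m]. The test sees only the keys of [F], so evaluation settles it even
    though the coefficients are arbitrary reals. *)
Lemma defect_component L p s (F : seq (R * seq nat)) (m : seq nat -> int) :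
  1 < p.1 ->
  defect L p (\sum_(x <- F) x.1 *: wmono (scale p.1) (iset x.2)) = 0 ->
  all (fun t => [&& 8%N \notin t, canonical_keys (zdefect L [:: (1, t)]) &
    coef (zdefect L [:: (1, t)]) s == m t]) (map snd F) ->
  8%N \notin s -> s = increasing (mem s) ->
  \sum_(x <- F) x.1 * (m x.2)%:~R = 0.
Proof.
move=> p1 /ffunP /(_ (iset s)) H /allP F8 s8 sc.
apply: (mulIf (weight_scale_neq0 p1 s8)); rewrite mul0r mulr_suml.
apply: (@mulfI _ (2^-1 : R)); first by rewrite invr_eq0 pnatr_eq0.
rewrite mulr0 -[RHS](ffunE (fun=> 0) (iset s)) -[RHS]H.
have defect_sum (T : Type) (r : seq T) (G : T -> ext R) :
    defect L p (\sum_(i <- r) G i) = \sum_(i <- r) defect L p (G i).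
  by rewrite /defect hodge_sum wedge_sumr big_split.
rewrite defect_sum sum_ffunE mulr_sumr !big_seq; apply: eq_bigr => x xF.
have /and3P[x8 xc /eqP <-] := F8 _ (map_f snd xF).
rewrite defectZ (_ : wmono _ _ = evalz (scale p.1) [:: (1, x.2)]); last first.
  by rewrite evalz_seq1 scale1r.
rewrite defect_evalz //; last by rewrite /= andbT.
rewrite !ffunE evalz_coef //.
by rewrite -[x.1 *: _]/(x.1 * (_ * _)); ring.
Qed.

End Hodge.

(** * Curvature *)

Section Bracket.
Variable R : realType.
Local Notation C := R[i].
Implicit Types (x y : 'rV[R]_9) (p : Mpoint R).

(** Entries 1 to 4 are placeholders, not coordinates of the bracket: they would be paired with the
    sigma and mu coefficients of a radial form, which are zero. *)
Definition bracket_coord (x y : 'rV[R]_9) (c : nat) : R :=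
  let X k := x 0 (inord k) in let Y k := y 0 (inord k) in
  let P i j := X i * Y j - X j * Y i in
  nth 0 [:: 0; 0; 0; 0; 0;
    - 2 * P 7%N 6%N - P 1%N 3%N - P 2%N 4%N;
    2 * P 7%N 5%N - P 2%N 3%N + P 1%N 4%N;
    2 * P 5%N 6%N + P 1%N 2%N - P 3%N 4%N;
    P 1%N 2%N + P 3%N 4%N] c.

Lemma bracket_coordE x y (c : nat) : (4 < c < 9)%N \/ c = 0%N ->
  left_coord (bracket (0, eta_mx x) (0, eta_mx y)) 0 (inord c) = bracket_coord x y c.
Proof.
move=> c49; rewrite left_coordE; last by case: c49 => [/andP[]//|->].
rewrite /bracket /= /bracket_coord.
case: c49 => [|->]; last by [].
case: c => [|[|[|[|[|[|[|[|[|c]]]]]]]]] // _.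
all: rewrite /= ?(cReB, cImB) ?(mulmx3E,mxE) ?[(1 %% 3)%N]/= ?[(2 %% 3)%N]/= /=.
all: first [by ring | by field].
Qed.

Definition radial_coef (b z p0 p1 p2 : R) (k : nat) : R :=
  nth 0 [:: b; 0; 0; 0; 0; p1; p2; p0; z] k.

Definition radial_form (b z p0 p1 p2 : R) : ext R :=
  b *: dr R + z *: zeta R + p0 *: kappa R + p1 *: nu1 R + p2 *: nu2 R.

Lemma radial_formE (b z p0 p1 p2 : R) (k : 'I_9) :
  radial_form b z p0 p1 p2 [set k]%SET = radial_coef b z p0 p1 p2 k.
Proof.
rewrite !ffunE !(inj_eq (@finset.set1_inj _)) -![_ *: _%:R]/(_ * _%:R).
by move: k; apply: ord9P; rewrite !inord_eq // /radial_coef inordK //=; ring.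
Qed.

(* The terms of [d (radial_form b z p0 p1 p2)], where [q0], [q1], [q2] stand for the
   [r]-derivatives of [p0], [p1], [p2]; the component [b dr] is closed. *)
Definition curvature_terms (z p0 p1 p2 q0 q1 q2 : R) : seq (R * (nat * nat)) :=
  [:: (q0, (0, 7)%N); (q1, (0, 5)%N); (q2, (0, 6)%N);
      (- (z + p0), (1, 2)%N); (p0 - z, (3, 4)%N); (- 2 * p0, (5, 6)%N);
      (- 2 * p1, (6, 7)%N); (2 * p2, (5, 7)%N);
      (p1, (1, 3)%N); (p1, (2, 4)%N); (p2, (2, 3)%N); (- p2, (1, 4)%N)].

Lemma big_ord9 (V : nmodType) (F : 'I_9 -> V) : \sum_i F i =
  F (inord 0) + (F (inord 1) + (F (inord 2) + (F (inord 3) + (F (inord 4) +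
  (F (inord 5) + (F (inord 6) + (F (inord 7) + F (inord 8)))))))).
Proof.
rewrite !big_ord_recl big_ord0 addr0; repeat congr (_ + _).
all: by congr F; apply: val_inj; rewrite /= inordK.
Qed.

(** The antisymmetrised deltas are the minors [P i j] of [bracket_coord] evaluated on two frame
    vectors. *)
Lemma sum_wedge_gen (i j : 'I_9) : (i < j)%N ->
  \sum_(a < 9) \sum_(b < 9 | (a < b)%N)
    ((a == i)%:R * (b == j)%:R - (a == j)%:R * (b == i)%:R)
      *: (gen R a \wedge gen R b) = gen R i \wedge gen R j.
Proof.
move=> ij; rewrite (bigD1 i) //= [X in _ + X]big1 ?addr0 => [|a ai].
  rewrite (bigD1 j) //= [X in _ + X]big1 ?addr0 => [|b /andP[ib bj]].
    by rewrite !eqxx (negPf (_ : i != j)) ?mul0r ?subr0 ?mulr1 ?scale1r //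
      neq_ltn ij.
  by rewrite (negPf bj) (negPf (_ : i != j)) ?mulr0 ?mul0r ?subrr ?scale0r //
    neq_ltn ij.
apply: big1 => b ab; rewrite (negPf ai) mul0r sub0r.
case: (eqVneq a j) ab => [->|_] ab; last by rewrite mul0r oppr0 scale0r.
by case: eqVneq ab => [->|_]; [rewrite ltnNge ltnW | rewrite mulr0 oppr0 scale0r].
Qed.

(** [t] stands for the derivative of [b]. Since [i < j], the index [j] is never 0 and [t] is never
    selected. *)
Lemma d1_coefficient (b z p0 p1 p2 q0 q1 q2 t : R) (i j : 'I_9) : (i < j)%N ->
  radial_coef t 0 q0 q1 q2 j *+ (i == inord 0)
  - \sum_(c < 9) radial_coef b z p0 p1 p2 c *
      left_coord (bracket (frame R i) (frame R j)) 0 c =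
  \sum_(x <- curvature_terms z p0 p1 p2 q0 q1 q2)
    x.1 * ((i == inord x.2.1)%:R * (j == inord x.2.2)%:R
           - (i == inord x.2.2)%:R * (j == inord x.2.1)%:R).
Proof.
move=> ij; have j0 : (j == inord 0) = false.
  by apply/eqP => jE; move: ij; rewrite jE inordK.
have -> : bracket (frame R i) (frame R j) =
  bracket (0, eta_mx (delta_mx 0 i)) (0, eta_mx (delta_mx 0 j)) by [].
rewrite big_ord9 /radial_coef !inordK //= !mul0r !add0r.
rewrite !bracket_coordE //; try by [left|right].
have dE (k : 'I_9) (c : nat) : delta_mx 0 k 0 (inord c) = (k == inord c)%:R :> R.
  by rewrite mxE eqxx eq_sym.
rewrite /bracket_coord /= !dE.
have -> : nth 0 [:: t; 0; 0; 0; 0; q1; q2; q0; 0] j =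
   q1 * (j == inord 5)%:R + q2 * (j == inord 6)%:R + q0 * (j == inord 7)%:R.
  by move: j ij j0 dE => j _ + _; move: j; apply: ord9P;
    rewrite !inord_eq // inordK //= => // _; ring.
rewrite !big_cons big_nil /= !j0 -[X in X - _]mulr_natr !mulr0n; ring.
Qed.

Lemma curvature_radial (A : Mform R) (b p0 p1 p2 : R -> R) (z : R) p :
  (forall q, in_M q -> A q = radial_form (b q.1) z (p0 q.1) (p1 q.1) (p2 q.1)) ->
  in_M p ->
  curvature A p = \sum_(x <- curvature_terms z (p0 p.1) (p1 p.1) (p2 p.1)
      (deriv_frame (inord 0) (radial p0) p) (deriv_frame (inord 0) (radial p1) p)
      (deriv_frame (inord 0) (radial p2) p))
    x.1 *: (gen R (inord x.2.1) \wedge gen R (inord x.2.2)).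
Proof.
move=> AE pM; rewrite /curvature /d1.
set T := curvature_terms _ _ _ _ _ _ _.
have lt_T (x : R * (nat * nat)) : x \in T -> ((inord x.2.1 : 'I_9) < (inord x.2.2 : 'I_9))%N.
  move=> /(map_f snd); have /allP T9 :
    all (fun y : nat * nat => (y.1 < y.2 < 9)%N) (map snd T) by [].
  by move=> /T9 /andP[x12 x2]; rewrite !inordK // (ltn_trans x12).
transitivity (\sum_(i < 9) \sum_(j < 9 | (i < j)%N) \sum_(x <- T)
    x.1 *: (((i == inord x.2.1)%:R * (j == inord x.2.2)%:R
           - (i == inord x.2.2)%:R * (j == inord x.2.1)%:R)
             *: (gen R i \wedge gen R j))).
  apply: eq_bigr => i _; apply: eq_bigr => j ij.
  under [RHS]eq_bigr do rewrite scalerA.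
  rewrite -scaler_suml; congr (_ *: _).
  rewrite -(d1_coefficient (b p.1) _ _ _ _ _ _ _ (deriv_frame (inord 0) (radial b) p)) //.
  have coefE q (k : 'I_9) : in_M q -> A q [set k]%SET =
      radial_coef (b q.1) z (p0 q.1) (p1 q.1) (p2 q.1) k.
    by move=> qM; rewrite AE // radial_formE.
  congr (_ - _); last by apply: eq_bigr => c _; rewrite coefE.
  have j0 : j != inord 0 by apply/eqP => jE; move: ij; rewrite jE inordK.
  have dE (k l : 'I_9) : deriv_frame k (fun q => A q [set l]%SET) p =
     deriv_frame k (radial (fun r => radial_coef (b r) z (p0 r) (p1 r) (p2 r) l)) p.
    by apply: deriv_frame_ext => // q qM; rewrite coefE.
  rewrite !dE (deriv_radial0 _ pM j0) subr0.
  case: (eqVneq i (inord 0)) => [->|i0]; last by rewrite deriv_radial0.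
  rewrite mulr1n.
  have cst0 (x : R) : deriv_frame (inord 0) (radial (fun=> x)) p = 0.
    by rewrite (deriv_radial _ pM (is_derive_cst _ _ _)) mul0rn.
  move: {ij j0} j; apply: ord9P; rewrite /radial_coef !inordK //=; exact: cst0.
under eq_bigr do rewrite exchange_big.
rewrite exchange_big /= !big_seq; apply: eq_bigr => x /lt_T xT.
rewrite -(sum_wedge_gen xT) scaler_sumr; apply: eq_bigr => i _.
by rewrite scaler_sumr.
Qed.

End Bracket.

(** * Solving the Sp(2) equations for radial forms *)

Section Instanton.
Variable R : realType.
Implicit Types (p : Mpoint R) (A : Mform R) (z r : R).

Lemma scale07 r : 1 < r -> scale r 0 * scale r 7 = r.
Proof.
move=> r1; have r0 : 0 < r by apply: lt_trans r1.
have r4 : 1 < r ^+ 4 by rewrite exprn_egt1.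
rewrite /scale /= sqrtrM ?exprn_ge0 ?ltW // sqrtrV; last by rewrite subr_ge0 ltW.
have : Num.sqrt (r ^+ 4 - 1) != 0 by rewrite sqrtr_eq0 -ltNge subr_gt0.
move: (Num.sqrt (r ^+ 4 - 1)) => s s0.
rewrite (_ : r ^+ 4 = (r ^+ 2) ^+ 2); last by rewrite -exprM.
rewrite sqrtr_sqr ger0_norm ?exprn_ge0 ?ltW //.
by field; rewrite s0 gt_eqF.
Qed.

Lemma scale12 r : 1 < r -> scale r 1 * scale r 2 = (r ^+ 2 - 1) / 2.
Proof.
move=> r1; have r2 : 1 < r ^+ 2 by rewrite exprn_egt1.
by rewrite /scale /= -expr2 sqr_sqrtr //; lra.
Qed.

Lemma scale34 r : 1 < r -> scale r 3 * scale r 4 = (r ^+ 2 + 1) / 2.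
Proof.
move=> r1; have r2 : 1 < r ^+ 2 by rewrite exprn_egt1.
by rewrite /scale /= -expr2 sqr_sqrtr //; lra.
Qed.

Definition weighted_terms r (T : seq (R * (nat * nat))) : seq (R * seq nat) :=
  [seq (x.1 * (scale r x.2.1 * scale r x.2.2)^-1, [:: x.2.1; x.2.2]) | x <- T].

(** The derivatives are hidden behind existentials: only components of the curvature free of them
    will be read. *)
Lemma curvature_weighted A (b p0 p1 p2 : R -> R) z p :
  (forall q, in_M q -> A q = radial_form (b q.1) z (p0 q.1) (p1 q.1) (p2 q.1)) ->
  in_M p -> exists q0 q1 q2, curvature A p =
   \sum_(x <- weighted_terms p.1 (curvature_terms z (p0 p.1) (p1 p.1) (p2 p.1) q0 q1 q2))
     x.1 *: wmono (scale p.1) (iset x.2).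
Proof.
move=> AE pM; have [r1 _] := pM; rewrite (curvature_radial AE pM).
set q0 := deriv_frame _ (radial p0) p; set q1 := deriv_frame _ (radial p1) p.
set q2 := deriv_frame _ (radial p2) p; exists q0, q1, q2; rewrite big_map.
set T := curvature_terms _ _ _ _ _ _ _.
have /allP T8 : all (fun y : nat * nat => (y.1 < y.2 < 8)%N) (map snd T) by [].
rewrite !big_seq; apply: eq_bigr => x /(map_f snd) /T8 xT.
by rewrite (wedge_genE r1 xT) scalerA.
Qed.

Lemma Sp2_radial A (b p0 p1 p2 : R -> R) z :
  (forall q, in_M q -> A q = radial_form (b q.1) z (p0 q.1) (p1 q.1) (p2 q.1)) ->
  Sp2_instanton A -> forall p, in_M p ->
  [/\ p0 p.1 = - (z / p.1 ^+ 2), p1 p.1 = 0 & p2 p.1 = 0].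
Proof.
move=> AE AI p pM; have [r1 _] := pM.
have [q0 [q1 [q2 FE]]] := curvature_weighted AE pM.
have F0 L := (defectP L p _).1 (AI p pM L); rewrite {}FE in F0.
(* The tables record [zdefect], hence the factor 2. The sign at [[:: 1; 3]] is negative because the
   shuffle of 1, 3 with its complement is odd. The keys carrying [q0], [q1] or [q2] all have entry
   0. *)
have := @defect_component _ LI p (hodge_key [:: 1; 3]%N) _ (fun t =>
  if (t == [:: 1; 3]%N) || (t == [:: 2; 4]%N) then -2 else 0) r1 (F0 LI).
move=> /(_ isT isT erefl); rewrite !big_cons big_nil /= => H1.
have := @defect_component _ LI p (hodge_key [:: 1; 4]%N) _ (fun t =>
  if t == [:: 1; 4]%N then 2 else if t == [:: 2; 3]%N then -2 else 0) r1 (F0 LI).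
move=> /(_ isT isT erefl); rewrite !big_cons big_nil /= => H2.
have := @defect_component _ LJ p (hodge_key [:: 1; 2]%N) _ (fun t =>
  if t == [:: 1; 2]%N then 2 else if t == [:: 3; 4]%N then -2 else 0) r1 (F0 LJ).
move=> /(_ isT isT erefl); rewrite !big_cons big_nil /= => H3.
have [i2 iN2] : 2%:~R = 2 :> R /\ (-2)%:~R = -2 :> R by split.
rewrite !mulr0z !mulr0 !add0r !addr0 ?i2 ?iN2 in H1 H2 H3.
have pos_inv i j : (i < 8)%N -> (j < 8)%N -> 0 < (scale p.1 i * scale p.1 j)^-1.
  by move=> i8 j8; rewrite invr_gt0 mulr_gt0 ?scale_gt0.
have aux (u v x : R) : 0 < u -> 0 < v -> x * u * (-2) + x * v * (-2) = 0 -> x = 0.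
  move=> u0 v0 E; have uv : u + v != 0 by lra.
  by apply: (mulIf uv); lra.
split.
- have r2 : 1 < p.1 ^+ 2 by rewrite exprn_egt1.
  rewrite scale12 // scale34 // in H3; move: (p.1 ^+ 2) r2 H3 => w w1 H3.
  have w0 : w != 0 by lra.
  apply: (mulIf w0); rewrite mulNr mulfVK //.
  have w2 : w - 1 != 0 by lra.
  have w3 : w + 1 != 0 by lra.
  (* This factor clears the denominators of [scale12] and [scale34]; what remains is
     $-2(z+Pw)=0$. *)
  move: (p0 p.1) H3 => P /(congr1 (fun s => s * ((w - 1) * (w + 1) / 4))).
  rewrite mul0r (_ : _ * _ = - (z + P) * (w + 1) - (P - z) * (w - 1)); first lra.
  by field; rewrite w2 w3.
- exact: aux (pos_inv 1%N 3%N isT isT) (pos_inv 2%N 4%N isT isT) H1.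
- apply: aux (pos_inv 2%N 3%N isT isT) (pos_inv 1%N 4%N isT isT) _.
  by rewrite -H2; ring.
Qed.

Lemma is_derive_inv_sqr z r : r != 0 ->
  is_derive r 1 (fun s : R => - (z / s ^+ 2)) (2 * z / r ^+ 3).
Proof.
move=> r0; have iD := is_derive_inv r0.
have E : (fun s : R => - (z / s ^+ 2)) = (- z) \*: ((fun s : R => s^-1) ^+ 2).
  by apply/funext => s; rewrite -mulNr -exprVn.
rewrite E; apply: is_derive_eq; rewrite /= expr1.
by rewrite -[_ *: _]/(_ * (_ * _)); field.
Qed.

Definition sp2_form z r : ext R := radial_form 0 z (- (z / r ^+ 2)) 0 0.

Lemma curvature_sp2 A z p : (forall q, in_M q -> A q = sp2_form z q.1) ->
  in_M p ->
  curvature A p = z *: ((2 / p.1 ^+ 3) *: (dr R \wedge kappa R)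
                - (1 + 1 / p.1 ^+ 2) *: (mu1 R \wedge mu2 R)
                - (1 - 1 / p.1 ^+ 2) *: (sigma1 R \wedge sigma2 R)
                + (2 / p.1 ^+ 2) *: (nu1 R \wedge nu2 R)).
Proof.
move=> AE pM; have [r1 _] := pM; have r0 : p.1 != 0 by rewrite gt_eqF // (lt_trans _ r1).
rewrite (@curvature_radial _ A (fun=> 0) (fun s => - (z / s ^+ 2)) (fun=> 0) (fun=> 0) z) //.
rewrite (deriv_radial _ pM (is_derive_inv_sqr z r0)) eqxx mulr1n.
rewrite (deriv_radial _ pM (is_derive_cst 0 _ _)) mul0rn.
rewrite !big_cons big_nil /= !mulr0 oppr0 !scale0r ?add0r ?addr0.
rewrite /dr /kappa /mu1 /mu2 /sigma1 /sigma2 /nu1 /nu2.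
rewrite !(scalerDr, scalerBr, scalerN, scalerA).
move: (gen R _ \wedge gen R _) (gen R _ \wedge gen R _) (gen R _ \wedge gen R _)
  (gen R _ \wedge gen R _) => E1 E2 E3 E4.
apply/ffunP => K; rewrite !ffunE -![_ *: _]/(_ * _).
by field.
Qed.

Lemma curvature_sp2_eval A z p : (forall q, in_M q -> A q = sp2_form z q.1) ->
  in_M p -> curvature A p =
    (2 * z / p.1 ^+ 4) *: evalz (scale p.1) [:: (1, [:: 0; 7]%N); (1, [:: 5; 6]%N)]
  - (2 * z / p.1 ^+ 2) *: evalz (scale p.1) [:: (1, [:: 1; 2]%N); (1, [:: 3; 4]%N)].
Proof.
move=> AE pM; have [r1 _] := pM; have r0 : 0 < p.1 by rewrite (lt_trans _ r1).
have r2 : 1 < p.1 ^+ 2 by rewrite exprn_egt1.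
rewrite (curvature_sp2 AE pM) !(@wedge_genE _ p) // !evalz_cons /evalz big_nil addr0.
rewrite scale07 // scale12 // scale34 // -expr2 !scale1r.
move: (wmono _ _) (wmono _ _) (wmono _ _) (wmono _ _) => E1 E2 E3 E4.
apply/ffunP => K; rewrite !ffunE -![_ *: _]/(_ * _).
have [w1 w2] : p.1 ^+ 2 - 1 != 0 /\ p.1 ^+ 2 + 1 != 0 by split; lra.
have w0 := lt0r_neq0 r0.
by field; rewrite w0 w1 w2.
Qed.

Lemma defect_sp2 A z L p : (forall q, in_M q -> A q = sp2_form z q.1) ->
  in_M p -> defect L p (curvature A p) = 0.
Proof.
move=> AE pM; have [r1 _] := pM; rewrite (curvature_sp2_eval AE pM).
by rewrite defectD -scaleNr !defectZ defect_07_56 // defect_12_34 // !scaler0 addr0.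
Qed.

Lemma sp2_not_flat A z : (forall q, in_M q -> A q = sp2_form z q.1) ->
  z != 0 -> ~ flat A.
Proof.
move=> AE z0 Aflat; pose p : Mpoint R := (2, 1%:M).
have p1 : 1 < p.1 by rewrite ltr1n.
have pM : in_M p by apply: in_M1.
have := Aflat p pM; rewrite (curvature_sp2_eval AE pM).
move/ffunP/(_ (iset [:: 0; 7]%N)); rewrite !ffunE !evalz_coef //= addr0 mul1r.
have := weight_scale_neq0 p1 (isT : 8%N \notin [:: 0; 7]%N).
move: (weight _ _) => w w0 /eqP; rewrite mul0r scaler0 subr0.
rewrite -[_ *: _]/(_ * _) mulf_eq0 (negPf w0) orbF !mulf_eq0 invr_eq0 (negPf z0).
by rewrite expf_eq0 /= !pnatr_eq0.
Qed.

End Instanton.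

(** * Invariant connections *)

Section Invariance.
Variable R : realType.
Local Notation C := R[i].
Implicit Types (p v q : Mpoint R) (A : Mform R) (X Y h z : 'M[C]_3).

Lemma conjCE (a : C) : Num.conj a = conjc a.
Proof. by []. Qed.

Lemma left_coord_eta (t : R) (x : 'rV[R]_9) (k : 'I_9) :
  left_coord (t, eta_mx x) 0 k = if k == inord 0 then t else x 0 k.
Proof.
move: k; apply: ord9P; rewrite left_coordE // inord_eq //=.
all: rewrite !mxE ?[(1 %% 3)%N]/= ?[(2 %% 3)%N]/= /=.
all: by field.
Qed.

Lemma su3_eta (x : 'rV[R]_9) : su3 (eta_mx x).
Proof.
split; last first.
  rewrite /mxtrace big_ord3 !mxE ?[(1 %% 3)%N]/= ?[(2 %% 3)%N]/= /=.
  by apply/eqP; rewrite eq_complex /=; apply/andP; split; apply/eqP; ring.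
apply: matrix3P; rewrite !mxE ?[(1 %% 3)%N]/= ?[(2 %% 3)%N]/= /= conjCE /=.
all: apply/eqP; rewrite eq_complex /= ?oppr0 ?opprK.
all: apply/andP; split; apply/eqP; ring.
Qed.

Definition frame_at h (k : 'I_9) : Mpoint R :=
  ((k == inord 0)%:R, h *m eta_mx (delta_mx 0 k)).

Lemma coframe_frame p (k j : 'I_9) : in_M p ->
  coframe p (frame_at p.2 k) 0 j = (j == k)%:R.
Proof.
move=> [_ /SU3_unit hu]; rewrite /coframe /frame_at /= mulKmx //.
rewrite left_coord_eta mxE eqxx /=; case: (eqVneq j (inord 0)) => [->|//].
by rewrite eq_sym.
Qed.

Lemma tangent_frame p (k : 'I_9) : in_M p -> tangent p (frame_at p.2 k).
Proof. by move=> [_ /SU3_unit hu]; rewrite /tangent mulKmx //; apply: su3_eta. Qed.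

Lemma eval1_frame A p (k : 'I_9) : in_M p ->
  eval1 A p (frame_at p.2 k) = A p [set k]%SET.
Proof.
move=> pM; rewrite /eval1 (bigD1 k) //= big1 => [|j jk].
  by rewrite coframe_frame // eqxx mulr1 addr0.
by rewrite coframe_frame // (negPf jk) mulr0.
Qed.

Lemma invariant_at1 A p (k : 'I_9) : is_invariant A -> in_M p ->
  A p [set k]%SET = A (p.1, 1%:M) [set k]%SET.
Proof.
move=> Ainv pM; have [p1 ph] := pM; have hu := SU3_unit ph.
rewrite -eval1_frame // -(Ainv (invmx p.2)) //; last exact: tangent_frame.
  rewrite mulVmx // /frame_at /= mulKmx // -eval1_frame; last exact: in_M1.
  by rewrite /frame_at /= mul1mx.
exact: SU3_inv.
Qed.

Lemma K0_embz z : K0 z -> exists t : R, z = embz (cos t +i* sin t).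
Proof.
case=> t ->; exists t; rewrite /embz /mx3 -[RHS]/(M33 _) /M33.
have -> : Num.conj ((cos t +i* sin t) ^+ 2) = cos (-2 * t) +i* sin (-2 * t).
  rewrite conjCE mulNr cosN sinN mulr_natl mulr2n cosD sinD expr2.
  by apply/eqP; rewrite eq_complex /=; apply/andP; split; apply/eqP; ring.
by [].
Qed.

Lemma cis_unit (t : R) : (cos t +i* sin t) * Num.conj (cos t +i* sin t) = 1.
Proof.
by rewrite -normCK -add_Re2_Im2 /= cos2Dsin2.
Qed.

Lemma K0_SU3 z : K0 z -> SU3 z.
Proof. by move=> /K0_embz[t ->]; apply: unitary_embz; apply: cis_unit. Qed.

(** [Y] is the Maurer-Cartan matrix of [v] conjugated by [z]; the relation avoids the inverse of [z]
    so that it can be checked entry by entry. *)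
Lemma coframe_right p v z (k : 'I_9) Y : SU3 z -> in_M p ->
  invmx p.2 *m v.2 *m z = z *m Y ->
  coframe (p.1, p.2 *m z) (v.1, v.2 *m z) 0 k = left_coord (v.1, Y) 0 k.
Proof.
move=> /SU3_unit zu [_ /SU3_unit hu] E; rewrite /coframe /=.
suff -> : invmx (p.2 *m z) *m (v.2 *m z) = Y by [].
have hzu : p.2 *m z \in unitmx by rewrite unitmx_mul hu.
have -> : v.2 *m z = p.2 *m z *m Y by rewrite -mulmxA -E -mulmxA mulKVmx.
by rewrite mulKmx.
Qed.

End Invariance.

(** Conjugation by a diagonal matrix fixes diagonal entries. Since kappa and zeta are read off the
    diagonal, they are invariant under right translation by $K_0$. *)
Lemma embz_diag (K : numClosedFieldType) (a : K) (W Y : 'M[K]_3) (i : 'I_3) :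
  W *m embz a = embz a *m Y -> a != 0 -> Y i i = W i i.
Proof.
move=> /matrixP /(_ i i) + a0; move: i; apply: ord3P.
all: rewrite !mulmx3E /embz /M33 !mxE /= ?[(1 %% 3)%N]/= ?[(2 %% 3)%N]/= /=.
all: rewrite !(mulr0, mul0r, addr0, add0r) mulrC => /esym /(mulfI _); apply => //.
by rewrite conjC_eq0 expf_neq0.
Qed.

(** * Consequences of invariance under $K_0$ *)

Section Reduction.
Variable R : realType.
Local Notation C := R[i].
Implicit Types (p v q : Mpoint R) (A : Mform R) (X Y h z : 'M[C]_3).

(* The witness is the element of angle [pi / 3]. *)
Lemma K0_reflection : exists2 z : 'M[C]_3, K0 z & forall k : 'I_9, (0 < k < 5)%N ->
  eta_mx (delta_mx 0 k) *m z = z *m eta_mx (- delta_mx 0 k).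
Proof.
pose t : R := pi / 3; pose c := cos t; pose s := sin t.
pose z : 'M[C]_3 := M33 [:: [:: c +i* s; 0; 0]; [:: 0; c +i* s; 0];
                           [:: 0; 0; (- c) +i* (- s)]].
exists z.
  exists t; rewrite /z (_ : -2 * t = t - pi); last by rewrite /t; field.
  have cE : cos (t - pi) = - c by rewrite /c -[in RHS](subrK pi t) cosDpi opprK.
  have sE : sin (t - pi) = - s by rewrite /s -[in RHS](subrK pi t) sinDpi opprK.
  by rewrite cE sE.
move=> k k14.
have dE (j : nat) : (4 < j < 9)%N -> (delta_mx 0 k : 'rV[R]_9) 0 (inord j) = 0.
  move=> /andP[j4 j9]; rewrite mxE eqxx /=; case: eqVneq => [E|//].
  by move: k14 j4; rewrite -E inordK // ltnS => /andP[_ /leq_ltn_trans H] /H; rewrite ltnn.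
move: (delta_mx 0 k) dE => x dE; have [x5 x6] := (dE 5%N isT, dE 6%N isT).
have [x7 x8] := (dE 7%N isT, dE 8%N isT).
clearbody c s; apply: matrix3P; rewrite !mulmx3E ?mxE.
all: rewrite ?[(1 %% 3)%N]/= ?[(2 %% 3)%N]/= /= ?mxE ?(x5, x6, x7, x8).
all: apply/eqP; rewrite eq_complex /=; apply/andP; split; apply/eqP; ring.
Qed.

Lemma coframe_K0_gen p (j : 'I_9) : in_M p ->
  coframe p (0, p.2 *m K0_gen R) 0 j = (j == inord 8)%:R.
Proof.
move=> [_ /SU3_unit hu]; rewrite /coframe /= mulKmx //.
move: j; apply: ord9P; rewrite left_coordE // inord_eq //=.
all: rewrite ?mxE ?[(1 %% 3)%N]/= ?[(2 %% 3)%N]/= /=.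
all: by field.
Qed.

Lemma invariant_form n A : is_connection n A -> is_invariant A ->
  exists b p0 p1 p2 : R -> R, smooth (radial b) /\ forall p, in_M p ->
    A p = radial_form (b p.1) n%:~R (p0 p.1) (p1 p.1) (p2 p.1).
Proof.
case=> A1 As AK An Ainv; pose a k r := A (r, 1%:M) [set inord k]%SET.
have aE k p : in_M p -> A p [set inord k]%SET = a k p.1.
  by move=> pM; rewrite (invariant_at1 _ Ainv).
exists (a 0%N), (a 7%N), (a 5%N), (a 6%N); split.
  by move=> m; apply: Ck_ext (As (inord 0) m) => p pM; apply: aE.
move=> p pM; have [p1 ph] := pM; apply/ffunP => I.
have [/cards1P[l ->]|I1] := boolP (#|I| == 1%N); last first.
  rewrite A1 // !ffunE.
  have I0 (k : 'I_9) : (I == [set k]%SET) = false.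
    by apply: contra_neqF I1 => /eqP ->; apply: cards1.
  by rewrite !I0 !scaler0 !addr0.
rewrite radial_formE.
have [z zK zk] := K0_reflection.
have a0 (k : 'I_9) : (0 < k < 5)%N -> A p [set k]%SET = 0.
  move=> k14; have zS := K0_SU3 zK.
  have hzM : in_M (p.1, p.2 *m z) by split=> //; apply: SU3_mul.
  have cE j : coframe (p.1, p.2 *m z) ((frame_at p.2 k).1, (frame_at p.2 k).2 *m z) 0 j
      = (- delta_mx 0 k : 'rV[R]_9) 0 j.
    rewrite (coframe_right (Y := eta_mx (- delta_mx 0 k)) _ zS pM); last first.
      by rewrite /frame_at /= mulKmx ?zk //; apply: SU3_unit.
    rewrite left_coord_eta /=; case: eqVneq => [->|//].
    case: eqVneq k14 => [->|k0 _]; first by rewrite inordK.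
    by rewrite !mxE eqxx /= eq_sym (negPf k0) oppr0.
  have := AK z p (frame_at p.2 k) zK pM (tangent_frame k pM).
  rewrite (eval1_frame _ _ pM) /eval1; under eq_bigr do rewrite cE.
  rewrite (bigD1 k) //= big1 => [|j jk]; last first.
    by rewrite !mxE (negPf jk) andbF oppr0 mulr0.
  (* Right invariance equates minus the coefficient at [p.2 *m z] with the coefficient at [p.2];
     left invariance equates the two coefficients, both taken at the same radius. So the coefficient
     is its own opposite. *)
  rewrite !mxE !eqxx /= addr0 (invariant_at1 _ Ainv hzM) -(invariant_at1 _ Ainv pM).
  move=> H; lra.
have a8 : A p [set inord 8]%SET = n%:~R.
  rewrite -(An p pM) /eval1 (bigD1 (inord 8)) //= big1 => [|j /negPf j8].
    by rewrite coframe_K0_gen // eqxx mulr1 addr0.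
  by rewrite coframe_K0_gen // j8 mulr0.
move: l; apply: ord9P; rewrite /radial_coef inordK //= ?a8 ?aE //.
all: by rewrite -aE // a0 // inordK.
Qed.

Lemma radial_form_connection (b p0 p1 p2 : R -> R) n A :
  (forall p, in_M p -> A p = radial_form (b p.1) n%:~R (p0 p.1) (p1 p.1) (p2 p.1)) ->
  (forall k : 'I_9, smooth (fun p => A p [set k]%SET)) ->
  (forall z p v, K0 z -> in_M p -> tangent p v ->
    eval1 A (p.1, p.2 *m z) (v.1, v.2 *m z) = eval1 A p v) ->
  is_connection n A.
Proof.
move=> AE As AK; split=> //.
  move=> p I pM I1; rewrite AE // !ffunE.
  have I0 (k : 'I_9) : (I == [set k]%SET) = false.
    by apply: contra_neqF I1 => /eqP ->; apply: cards1.
  by rewrite !I0 !scaler0 !addr0.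
move=> p pM; rewrite /eval1 (bigD1 (inord 8)) //= big1 => [|j /negPf j8].
  by rewrite coframe_K0_gen // eqxx mulr1 addr0 AE // radial_formE /radial_coef inordK.
by rewrite coframe_K0_gen // j8 mulr0.
Qed.

Lemma sp2_connection (n : int) A : (forall p, A p = sp2_form n%:~R p.1) ->
  is_connection n A.
Proof.
move=> AE; pose z : R := n%:~R.
have AE' p (k : 'I_9) : A p [set k]%SET = radial_coef 0 z (- (z / p.1 ^+ 2)) 0 0 k.
  by rewrite AE radial_formE.
apply: (@radial_form_connection (fun=> 0) (fun r => - (z / r ^+ 2)) (fun=> 0) (fun=> 0)).
- by move=> p _; rewrite AE.
- move=> k; have Cz m : Cm m (fun r : R => - (z / r ^+ 2)).
    have -> : (fun r : R => - (z / r ^+ 2)) =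
        (fun=> - z) \* ((fun r => r^-1) \* (fun r => r^-1)).
      by apply/funext => r /=; rewrite -invfM -expr2 mulNr.
    by apply: Cm_mul; [apply: Cm_cst | apply: Cm_mul; apply: Cm_inv].
  move=> m; apply: (@Ck_ext _ m (radial (fun r => radial_coef 0 z (- (z / r ^+ 2)) 0 0 k))).
    by move=> p _; rewrite AE'.
  apply: Cm_Ck; move: k; apply: ord9P; rewrite /radial_coef inordK //=;
    first [exact: Cm_cst | exact: Cz].
- move=> h p v hK pM tv.
  rewrite /eval1; apply: eq_bigr => k _; rewrite !AE' /=.
  have [k7|k7] := ltnP k 7.
    have -> : radial_coef 0 z (- (z / p.1 ^+ 2)) 0 0 k = 0.
      by move: k k7; apply: ord9P; rewrite /radial_coef inordK.
    by rewrite !mul0r.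
  congr (_ * _).
  pose Y := invmx h *m (invmx p.2 *m v.2) *m h.
  have hS := K0_SU3 hK; have hu := SU3_unit hS.
  have E : invmx p.2 *m v.2 *m h = h *m Y by rewrite /Y -(mulmxA (invmx h)) mulKVmx.
  rewrite (coframe_right _ hS pM E) /coframe.
  have YE (i : 'I_3) : Y i i = (invmx p.2 *m v.2) i i.
    have [t hE] := K0_embz hK; move: E; rewrite hE => /embz_diag; apply.
    by apply/eqP => e0; have := cis_unit t; rewrite e0 mul0r => /eqP; rewrite eq_sym oner_eq0.
  by move: k k7; apply: ord9P; rewrite inordK // => _; rewrite !left_coordE //= !YE.
Qed.

End Reduction.

(** * Comparison with Spin(7)-instantons, and uniqueness up to gauge *)

Section Final.
Variable R : realType.
Implicit Types (p v q : Mpoint R) (A B : Mform R).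

Lemma inv_connectionE n (p0 p1 p2 : R -> R) p :
  inv_connection n p0 p1 p2 p =
  radial_form 0 n%:~R (p0 p.1) (p1 p.1) (p2 p.1).
Proof. by rewrite /radial_form scale0r add0r. Qed.

Lemma sp2_param L n p :
  inv_connection n (param0 L n 0) (param1 L 0) (param2 L 0) p =
  sp2_form n%:~R p.1 :> ext R.
Proof.
rewrite inv_connectionE /sp2_form; congr radial_form.
- by case: L; rewrite /= ?mul0r ?addr0 // mul1r mulNr mulrC.
- by case: L; rewrite /= mul0r.
- by case: L; rewrite /= mul0r.
Qed.

Lemma sp2_form_Sp2 A (z : R) : (forall q, in_M q -> A q = sp2_form z q.1) ->
  Sp2_instanton A.
Proof. by move=> AE p pM L; apply/defectP/(defect_sp2 L AE pM). Qed.

(** Each [Phi] is a combination of the three half-squares with signs adding up to 1, and all three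
    half-squares have the same wedge product with the curvature. *)
Lemma Sp2_Spin7 A L : Sp2_instanton A -> Spin7_instanton L A.
Proof.
move=> AI p pM; set F := curvature A p; set h := hodge p F.
pose S L' := 2^-1 *: (omega L' p \wedge omega L' p).
have SE L' : S L' \wedge F = - h by rewrite /h (AI p pM L') opprK.
have wedgeNl (u w : ext R) : (- u) \wedge w = - (u \wedge w).
  by rewrite -scaleN1r wedgeZl scaleN1r.
case: L; rewrite /Phi !(scalerDr, scalerN) -![2^-1 *: _]/(S _) !(wedgeDl, wedgeNl) !SE.
- by rewrite opprK subrK opprK.
- by rewrite opprK subrr sub0r opprK.
- by rewrite opprK addNr sub0r opprK.
Qed.

(** At zero constants the three parametrizations all reduce to [sp2_form], whose defects vanish;
    this gives the converse. *)
Lemma Sp2_Spin7_with (n : int) A (p0 p1 p2 : R -> R) L :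
  eq_on_M A (inv_connection n p0 p1 p2) ->
  Sp2_instanton A <-> Spin7_instanton_with L n 0 0 0 A.
Proof.
move=> AE; have AE' q : in_M q ->
    A q = radial_form 0 n%:~R (p0 q.1) (p1 q.1) (p2 q.1).
  by move=> qM; rewrite AE // inv_connectionE.
split=> [AI|[_ AS]].
  split; first exact: Sp2_Spin7.
  move=> p pM; rewrite sp2_param AE' //.
  by have [-> -> ->] := @Sp2_radial _ _ (fun=> 0) _ _ _ _ AE' AI p pM.
by apply: (@sp2_form_Sp2 _ n%:~R) => q qM; rewrite AS // sp2_param.
Qed.

Lemma coframe_dr p (j : 'I_9) : coframe p (1, 0) 0 j = (j == inord 0)%:R.
Proof.
rewrite /coframe mulmx0; move: j; apply: ord9P; rewrite left_coordE // inord_eq //=.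
all: rewrite ?mxE /=; by field.
Qed.

Lemma sp2_gauge (n : int) A B : (forall p, in_M p -> A p = sp2_form n%:~R p.1) ->
  is_connection n B -> is_invariant B -> Sp2_instanton B ->
  gauge_equivalent A B.
Proof.
move=> AE Bn Binv BI; have [b [p0 [p1 [p2 [bs BE]]]]] := invariant_form Bn Binv.
have bC := (smooth_radialP b).1 bs.
have [G GD] : exists G, forall r : R, 1 < r -> is_derive r 1 G (b r).
  by apply: primitive_exists => r r1; apply: (bC 0%N).
have CS m := Cm_cos_sin m GD bC.
exists (fun p => Complex (cos (G p.1)) (sin (G p.1))) => u1 u2; split.
- split; [apply: (smooth_radialP (cos \o G)).2 => m |
          apply: (smooth_radialP (sin \o G)).2 => m]; by have [] := CS m.
- by move=> p pM; rewrite /= cos2Dsin2 sqrtr1.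
- by [].
move=> p pM; have [p1' _] := pM; have GDp := GD _ p1'.
have d1 (k : 'I_9) : deriv_frame k u1 p = (- sin (G p.1) * b p.1) *+ (k == inord 0).
  exact: (deriv_radial _ pM (is_derive1_comp (is_derive_cos _) GDp)).
have d2 (k : 'I_9) : deriv_frame k u2 p = (cos (G p.1) * b p.1) *+ (k == inord 0).
  exact: (deriv_radial _ pM (is_derive1_comp (is_derive_sin _) GDp)).
rewrite (bigD1 (inord 0)) //= big1 => [|j /negPf j0]; last first.
  by rewrite d1 d2 j0 !mulr0n !mulr0 subrr scale0r.
rewrite d1 d2 eqxx !mulr1n addr0 AE // BE //.
have [-> -> ->] := Sp2_radial BE BI pM.
rewrite /sp2_form /radial_form !scale0r !addr0 add0r.
rewrite (_ : _ - _ = b p.1); first by rewrite -addrA [LHS]addrC.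
have := cos2Dsin2 (G p.1); rewrite /u1 /u2 /= => E.
by rewrite -[RHS]mul1r -E; ring.
Qed.

End Final.

Theorem theorem5p6 (R : realType) (n : int) :
  (forall A : Mform R,
     is_connection n A -> is_invariant A -> temporal_gauge A ->
     [/\ exists p0 p1 p2 : R -> R,
           eq_on_M A (inv_connection n p0 p1 p2),
         Sp2_instanton A <-> Spin7_instanton_with LI n 0 0 0 A,
         Sp2_instanton A <-> Spin7_instanton_with LJ n 0 0 0 A &
         Sp2_instanton A <-> Spin7_instanton_with LK n 0 0 0 A]) /\
  (let A : Mform R := fun p =>
     n%:~R *: zeta R - (n%:~R / p.1 ^+ 2) *: kappa R in
   [/\ is_connection n A, is_invariant A & Sp2_instanton A] /\
   (forall B : Mform R,
      is_connection n B -> is_invariant B -> Sp2_instanton B ->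
      gauge_equivalent A B) /\
   (forall p : Mpoint R, in_M p ->
      curvature A p =
      n%:~R *: ((2 / p.1 ^+ 3) *: (dr R \wedge kappa R)
                - (1 + 1 / p.1 ^+ 2) *: (mu1 R \wedge mu2 R)
                - (1 - 1 / p.1 ^+ 2) *: (sigma1 R \wedge sigma2 R)
                + (2 / p.1 ^+ 2) *: (nu1 R \wedge nu2 R))) /\
   (n <> 0 -> ~ flat A)).
Proof.
split=> [A An Ainv At|].
  have [b [p0 [p1 [p2 [_ AE]]]]] := invariant_form An Ainv.
  have AS : eq_on_M A (inv_connection n p0 p1 p2).
    move=> p pM; rewrite inv_connectionE AE //; congr radial_form.
    have := At p pM; rewrite /eval1 (bigD1 (inord 0)) //= big1 => [|j /negPf j0].
      by rewrite coframe_dr // eqxx mulr1 addr0 AE // radial_formE /radial_coef inordK.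
    by rewrite coframe_dr // j0 mulr0.
  split; [by exists p0, p1, p2 | | | ]; exact: Sp2_Spin7_with AS.
move=> A; have AE p : A p = sp2_form n%:~R p.1.
  by rewrite /sp2_form /radial_form !scale0r add0r !addr0 scaleNr.
split; [split | split; [|split]].
- exact: sp2_connection.
- move=> g p v gS pM tv; rewrite /eval1; apply: eq_bigr => k _.
  rewrite !AE /=; congr (_ * _); rewrite /coframe /=.
  have hu : p.2 \in unitmx by case: pM => _ /SU3_unit.
  have gu := SU3_unit gS; rewrite -{1}(mulKVmx hu v.2) (mulmxA g) mulKmx //.
  by rewrite unitmx_mul gu.
- by apply: sp2_form_Sp2 => q _; apply: AE.
- by move=> B; apply: sp2_gauge => p _; apply: AE.
- by move=> p pM; apply: curvature_sp2.
move=> n0; apply: (@sp2_not_flat _ _ n%:~R) => [q _|]; first exact: AE.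
by rewrite intr_eq0; apply/eqP.
Qed.
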